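(* A full order $\mathcal R$ of $\mathbb A=\mathbb M_2(K)$ is a ghost intersection of maximal orders if and only if its Gorenstein closure $\mathrm{Gor}(\mathcal R)$ is a Bass order.
   Context: $K$ is a non-archimedean local field with ring of integers $\mathcal O_K$ and uniformizer $\pi_K$; $\mathbb A=\mathbb M_2(K)$ with identity $\mathbf 1$. An order of $\mathbb A$ is a subring containing $\mathbf 1$ which is a finitely generated $\mathcal O_K$-submodule; it is full if it spans $\mathbb A$ over $K$. For a finite extension $L/K$, the analogous notions apply to $\mathcal O_L$-orders in $\mathbb M_2(L)\supseteq\mathbb A$. A full order $\mathcal R$ is Gorenstein if its codifferent $\{a\in\mathbb A:\mathrm{tr}(a\mathcal R)\subseteq\mathcal O_K\}$ is invertible as a two-sided fractional $\mathcal R$-ideal; equivalently, $\mathcal R$ admits no expression $\mathcal R=\mathcal O_K\mathbf 1+I\mathcal R'$ with $\mathcal R'$ an order and $I\subsetneq\mathcal O_K$ a nonzero ideal. Every full order $\mathcal R$ can be written uniquely as $\mathcal R=\mathcal O_K\mathbf 1+I\tilde{\mathcal R}$ with $\tilde{\mathcal R}$ a Gorenstein order and $I$ a nonzero ideal of $\mathcal O_K$; $\tilde{\mathcal R}=\mathrm{Gor}(\mathcal R)$ is the Gorenstein closure of $\mathcal R$. A full order is Bass if every order containing it is Gorenstein. A ghost intersection of maximal orders is a full order of the form $\mathcal R=\mathbb A\cap\bigcap_{i=1}^n\mathcal D_i$, where $L/K$ is some finite field extension and $\mathcal D_1,\dots,\mathcal D_n$ are maximal $\mathcal O_L$-orders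 in $\mathbb M_2(L)$. *)

(* Defs.v *)
From HB Require Import structures.
From mathcomp Require Import all_boot all_order all_algebra all_field.
Set Implicit Arguments. Unset Strict Implicit. Unset Printing Implicit Defensive.
Import GRing.Theory Num.Theory.
Local Open Scope ring_scope.

(** * Non-archimedean local fields: complete discretely valued fields
      with finite residue field.  [v] is only meaningful on nonzero elements. *)
Section LocalField.
Variables (K : fieldType) (v : K -> int).

(* "x = 0 or v(x) >= N", i.e. v(x) >= N with the convention v(0) = +oo *)
Definition vge (x : K) (N : int) : Prop := x = 0 \/ N <= v x.

Definition is_discrete_valuation : Prop :=
  [/\ forall x y, x != 0 -> y != 0 -> v (x * y) = v x + v y,
      forall x y, x != 0 -> y != 0 -> x + y != 0 ->
        (v x <= v (x + y)) || (v y <= v (x + y))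
    & exists pi : K, pi != 0 /\ v pi = 1].

Definition valring (x : K) : Prop := vge x 0.
Definition valideal (x : K) : Prop := vge x 1.

Definition residue_field_finite : Prop :=
  exists s : seq K, (forall a, a \in s -> valring a) /\
    forall x, valring x -> exists2 a, a \in s & valideal (x - a).

Definition v_cauchy (u : nat -> K) : Prop :=
  forall N : int, exists M : nat, forall m n, (M <= m)%N -> (M <= n)%N ->
    vge (u m - u n) N.

Definition v_converges (u : nat -> K) (l : K) : Prop :=
  forall N : int, exists M : nat, forall n, (M <= n)%N -> vge (u n - l) N.

Definition v_complete : Prop :=
  forall u, v_cauchy u -> exists l, v_converges u l.

Definition nonarch_local_field : Prop :=
  [/\ is_discrete_valuation, residue_field_finite & v_complete].

End LocalField.

Section Orders.
Variables (F : fieldType) (O : F -> Prop).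

Definition Mset := 'M[F]_2 -> Prop.

Definition set_sub (X Y : Mset) : Prop := forall x, X x -> Y x.
Definition set_eq (X Y : Mset) : Prop := forall x, X x <-> Y x.

Definition O_span (s : seq 'M[F]_2) (x : 'M[F]_2) : Prop :=
  exists c : 'I_(size s) -> F, (forall i, O (c i)) /\
    x = \sum_(i < size s) c i *: nth 0 s i.

Definition fg_submodule (X : Mset) : Prop :=
  exists s : seq 'M[F]_2, forall x, X x <-> O_span s x.

Definition spans (X : Mset) : Prop :=
  forall a : 'M[F]_2, exists n (r : 'I_n -> 'M[F]_2) (k : 'I_n -> F),
    (forall i, X (r i)) /\ a = \sum_(i < n) k i *: r i.

Definition is_order (X : Mset) : Prop :=
  [/\ X 1, (forall x y, X x -> X y -> X (x + y)), (forall x, X x -> X (- x)),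
      (forall x y, X x -> X y -> X (x * y)) & fg_submodule X].

Definition full_order (X : Mset) : Prop := is_order X /\ spans X.

Definition maximal_order (X : Mset) : Prop :=
  is_order X /\ forall Y, is_order Y -> set_sub X Y -> set_sub Y X.

Definition full_lattice (X : Mset) : Prop := fg_submodule X /\ spans X.

Definition prod_set (X Y : Mset) (z : 'M[F]_2) : Prop :=
  exists n (a b : 'I_n -> 'M[F]_2), (forall i, X (a i) /\ Y (b i)) /\
    z = \sum_(i < n) a i * b i.

Definition codifferent (R : Mset) (a : 'M[F]_2) : Prop :=
  forall r, R r -> O (\tr (a * r)).

Definition two_sided_frac_ideal (R J : Mset) : Prop :=
  full_lattice J /\ forall r j, R r -> J j -> J (r * j) /\ J (j * r).

Definition invertible_frac_ideal (R J : Mset) : Prop :=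
  two_sided_frac_ideal R J /\
  exists J', [/\ two_sided_frac_ideal R J', set_eq (prod_set J J') R
               & set_eq (prod_set J' J) R].

Definition Gorenstein (R : Mset) : Prop :=
  full_order R /\ invertible_frac_ideal R (codifferent R).

Definition Bass (R : Mset) : Prop :=
  full_order R /\ forall R', is_order R' -> set_sub R R' -> Gorenstein R'.

Definition nz_ideal (I : F -> Prop) : Prop :=
  [/\ (forall x, I x -> O x), I 0, (forall x y, I x -> I y -> I (x + y)),
      (forall a x, O a -> I x -> I (a * x)) & exists x, I x /\ x != 0].

Definition ideal_mul (I : F -> Prop) (X : Mset) (z : 'M[F]_2) : Prop :=
  exists n (c : 'I_n -> F) (x : 'I_n -> 'M[F]_2),
    (forall i, I (c i) /\ X (x i)) /\ z = \sum_(i < n) c i *: x i.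

Definition gor_closure (R Rt : Mset) : Prop :=
  Gorenstein Rt /\ exists I, nz_ideal I /\
    set_eq R (fun z => exists k y, [/\ O k, ideal_mul I Rt y & z = k%:M + y]).

End Orders.

Section Ghost.
Variables (K : fieldType) (v : K -> int).

Definition int_closure (L : fieldExtType K) (x : L) : Prop :=
  exists p : {poly K}, [/\ p \is monic, forall i, valring v p`_i
                        & root (map_poly (in_alg L) p) x].

Definition ghost_intersection (R : 'M[K]_2 -> Prop) : Prop :=
  exists (L : fieldExtType K) (n : nat) (D : 'I_n -> 'M[L]_2 -> Prop),
    [/\ (0 < n)%N, forall i, maximal_order (@int_closure L) (D i)
      & forall a : 'M[K]_2, R a <-> forall i, D i (map_mx (in_alg L) a)].

End Ghost.

(* Main.v *)
From HB Require Import structures.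
Require Import Defs.
From mathcomp Require Import all_boot all_order all_algebra all_field.
From mathcomp Require Import ring zify.
From Stdlib Require Import Classical.
Set Implicit Arguments. Unset Strict Implicit. Unset Printing Implicit Defensive.
Import Order.TTheory GRing.Theory Num.Theory.
Local Open Scope ring_scope.

(* Write M for M_2(O). A full order is Bass if and only if it lies in no order
   O + pi P M P^-1: such an order is not Gorenstein, and an order R avoiding all of them
   contains an element C that is, in suitable coordinates, the companion matrix of a
   polynomial that is separable modulo pi or Eisenstein. Then O[C] is integrally closed, so
   its ideals are principal, R = O[C] + e12 rho O[C] up to conjugation, and the codifferent
   of R is generated by one element.

   If R is a ghost intersection, take the largest k with R contained in some
   O + pi^k Q M Q^-1. The elements m of Q M Q^-1 with pi^k m in R form an order, because by
   the Smith normal form over O_L the product of two such m again has pi^k m m' in every D_i.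
   By maximality of k this order is Bass, and R = O + pi^k Rt.

   Conversely, let R = O + c Rt with Rt = O[C] + e12 rho O[C], and let L contain the
   eigenvalues a, b of C. Membership of g in R is expressed by the form
   phi_g(p) = (1, -p) g (p, 1)^T, namely by phi_g(a) in c rho(a) O_L, phi_g(b) in
   c rho(b) O_L and g in O + c M. Inside M_2(O_L) the maximal order attached to the ball of
   centre p and radius r is cut out by phi_g(p) in r O_L, and g in O + c M amounts to three
   such conditions, at p = 0, 1 and infinity. *)

(** * Valuation rings *)

(** No valuation is ever constructed on L. The integral closure of O enters the matrix arguments
    only as a ring that contains x or x^-1 for every x in L, and proving this is where completeness
    is used, through Hensel's lemma. The Hermite and Smith forms are therefore done for such rings,
    where a finite list with a nonzero entry has a nonzero entry dividing all the others. That O[C]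
    is integrally closed is reduced to this: if the trace and the norm of s C + t are in O, so are s
    and t. It serves twice, to show that an element of least norm generates an ideal of O[C], and to
    recover coordinates in O from their values at a and b. The form phi_g comes from the eigenvector
    (p, 1)^T of C, where p is a or b: the row (1, -p) annihilates it, so phi_g(p) ignores the O[C]
    part of g and sees only the e12 rho part. The points 0, 1 and infinity of the projective line
    stay distinct over every residue field, even one with two elements, so the values of phi_g there
    control its three coefficients. *)

Definition valuation_ring (F : fieldType) (V : F -> Prop) : Prop :=
  [/\ V 1, forall x y, V x -> V y -> V (x - y),
    forall x y, V x -> V y -> V (x * y) & forall x, V x \/ V x^-1].

Section ValuationRing.
Variables (F : fieldType) (V : F -> Prop).
Hypothesis hV : valuation_ring V.

Lemma vr1 : V 1. Proof. by case: hV. Qed.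
Lemma vrB x y : V x -> V y -> V (x - y). Proof. by case: hV => _ h _ _; apply: h. Qed.
Lemma vrM x y : V x -> V y -> V (x * y). Proof. by case: hV => _ _ h _; apply: h. Qed.
Lemma vr_total x : V x \/ V x^-1. Proof. by case: hV. Qed.
Lemma vr0 : V 0. Proof. by rewrite -(subrr 1); apply: vrB vr1 vr1. Qed.
Lemma vrN x : V x -> V (- x). Proof. by rewrite -sub0r; apply: vrB vr0. Qed.
Lemma vrD x y : V x -> V y -> V (x + y).
Proof. by move=> hx hy; rewrite -[y]opprK; apply: vrB => //; apply: vrN. Qed.
Lemma vr_sum (I : Type) (r : seq I) (P : pred I) (G : I -> F) :
  (forall i, P i -> V (G i)) -> V (\sum_(i <- r | P i) G i).
Proof. by move=> h; apply: (big_ind V) => //; [apply: vr0|apply: vrD]. Qed.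

(** Stands in for an entry of least valuation: a finitely generated ideal of a valuation ring is
    generated by one of the given generators. *)
Lemma vr_seq_divisor (s : seq F) : (exists2 x, x \in s & x != 0) ->
  exists x, [/\ x \in s, x != 0 & forall y, y \in s -> V (y / x)].
Proof.
elim: s => [|a s IH]; first by case.
case: (classic (exists2 x, x \in s & x != 0)) => [/IH[x [xs x0 hx]] _|no [b]].
  case: (classic (V (a / x))) => h.
    exists x; split=> //; first by rewrite inE xs orbT.
    by move=> y; rewrite inE => /orP[/eqP->//|/hx].
  have a0 : a != 0 by apply/eqP => a0; apply: h; rewrite a0 mul0r; apply: vr0.
  exists a; split=> //; first by rewrite inE eqxx.
  move=> y; rewrite inE => /orP[/eqP->|/hx hy]; first by rewrite divff //; apply: vr1.
  have -> : y / a = (y / x) * (a / x)^-1 by rewrite invf_div; field; rewrite a0 x0.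
  by apply: vrM => //; case: (vr_total (a / x)).
rewrite inE => /orP[/eqP-> a0|bs b0]; last by case: no; exists b.
exists a; split=> //; first by rewrite inE eqxx.
move=> y; rewrite inE => /orP[/eqP->|ys]; first by rewrite divff //; apply: vr1.
have [->|y0] := eqVneq y 0; first by rewrite mul0r; apply: vr0.
by case: no; exists y.
Qed.

End ValuationRing.

Ltac vr_closed hV := repeat first [ assumption | exact: (vr1 hV) | exact: (vr0 hV)
  | apply: (vrD hV) | apply: (vrM hV) | apply: (vrN hV)].


(** * Discrete valuations and Hensel's lemma *)

Section Valuation.
Variables (K : fieldType) (v : K -> int).
Hypothesis hv : is_discrete_valuation v.

Lemma val_mul x y : x != 0 -> y != 0 -> v (x * y) = v x + v y.
Proof. by case: hv => H _ _; apply: H. Qed.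

Lemma val_one : v 1 = 0.
Proof.
have n1 : (1 : K) != 0 by apply: oner_neq0.
by have := val_mul n1 n1; rewrite mulr1 => h; lia.
Qed.

Lemma val_opp x : v (- x) = v x.
Proof.
have [->|x0] := eqVneq x 0; first by rewrite oppr0.
have n1 : (-1 : K) != 0 by rewrite oppr_eq0 oner_neq0.
have := val_mul n1 n1; rewrite mulrNN mulr1 val_one => h.
by rewrite -mulN1r val_mul //; lia.
Qed.

Lemma val_inv x : x != 0 -> v x^-1 = - v x.
Proof.
move=> x0; have xV : x^-1 != 0 by rewrite invr_eq0.
have := val_mul x0 xV; rewrite divff // val_one => h; lia.
Qed.

Lemma val_exp x n : x != 0 -> v (x ^+ n) = v x *+ n.
Proof.
move=> x0; elim: n => [|n IH]; first by rewrite expr0 val_one.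
by rewrite exprS val_mul ?expf_neq0 // IH mulrS.
Qed.

Lemma vge0 N : vge v 0 N. Proof. by left. Qed.

Lemma vgeE x N : x != 0 -> vge v x N <-> N <= v x.
Proof. by move=> x0; split=> [[xe|//]|]; [rewrite xe eqxx in x0|right]. Qed.

Lemma vge_le x M N : N <= M -> vge v x M -> vge v x N.
Proof. by move=> NM [->|h]; [left|right; apply: le_trans h]. Qed.

Lemma vgeN x N : vge v x N -> vge v (- x) N.
Proof. by case=> [->|h]; [left; rewrite oppr0|right; rewrite val_opp]. Qed.

Lemma vgeD x y N : vge v x N -> vge v y N -> vge v (x + y) N.
Proof.
have [->|x0] := eqVneq x 0; first by rewrite add0r.
have [->|y0] := eqVneq y 0; first by rewrite addr0.
have [->|xy0] := eqVneq (x + y) 0; first by move=> _ _; apply: vge0.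
rewrite !vgeE // => hx hy; case: hv => _ /(_ _ _ x0 y0 xy0)/orP[] h _.
- exact: le_trans h.
- exact: le_trans h.
Qed.

Lemma vgeB x y N : vge v x N -> vge v y N -> vge v (x - y) N.
Proof. by move=> hx hy; apply: vgeD => //; apply: vgeN. Qed.

Lemma vgeM x y M N : vge v x M -> vge v y N -> vge v (x * y) (M + N).
Proof.
have [->|x0] := eqVneq x 0; first by rewrite mul0r => _ _; apply: vge0.
have [->|y0] := eqVneq y 0; first by rewrite mulr0 => _ _; apply: vge0.
by rewrite !vgeE ?mulf_neq0 // val_mul // => hx hy; apply: lerD.
Qed.

Lemma vge_sum (I : Type) (r : seq I) (P : pred I) (F : I -> K) N :
  (forall i, P i -> vge v (F i) N) -> vge v (\sum_(i <- r | P i) F i) N.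
Proof. by move=> h; apply: (big_ind (fun z => vge v z N)) => //; [apply: vge0|move=> *; apply: vgeD]. Qed.

Lemma vge_all0 x : (forall n : nat, vge v x n%:Z) -> x = 0.
Proof.
move=> h; apply/eqP; apply/negPn/negP => x0.
by have := h `|v x|.+1; rewrite vgeE // => h1; lia.
Qed.

Lemma vge1 : vge v 1 0.
Proof. by right; rewrite val_one. Qed.

Lemma valring_valuation : valuation_ring (valring v).
Proof.
split; first exact: vge1.
- by move=> x y; apply: vgeB.
- by move=> x y hx hy; rewrite /valring -(addr0 0); apply: vgeM.
- move=> x; have [->|x0] := eqVneq x 0; first by left; apply: vge0.
  by rewrite /valring !vgeE ?invr_eq0 // val_inv //; case: (leP 0 (v x)); [left|right; lia].
Qed.

(** A lower bound for the Gauss valuation of p. *)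
Definition Pge (k : int) (p : {poly K}) := forall i, vge v p`_i k.

Lemma Pge0 k : Pge k 0.
Proof. by move=> i; rewrite coef0; apply: vge0. Qed.

Lemma PgeD k p q : Pge k p -> Pge k q -> Pge k (p + q).
Proof. by move=> hp hq i; rewrite coefD; apply: vgeD. Qed.

Lemma PgeN k p : Pge k p -> Pge k (- p).
Proof. by move=> hp i; rewrite coefN; apply: vgeN. Qed.

Lemma PgeB k p q : Pge k p -> Pge k q -> Pge k (p - q).
Proof. by move=> hp hq; apply: PgeD => //; apply: PgeN. Qed.

Lemma PgeM j k p q : Pge j p -> Pge k q -> Pge (j + k) (p * q).
Proof. by move=> hp hq i; rewrite coefM; apply: vge_sum => l _; apply: vgeM. Qed.

Lemma Pge_le j k p : j <= k -> Pge k p -> Pge j p.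
Proof. by move=> jk hp i; apply: vge_le (hp i). Qed.

Lemma PgeMl k p q : Pge 0 p -> Pge k q -> Pge k (p * q).
Proof. by move=> hp hq; rewrite -[k]add0r; apply: PgeM. Qed.

Lemma PgeMr k p q : Pge k p -> Pge 0 q -> Pge k (p * q).
Proof. by move=> hp hq; rewrite -[k]addr0; apply: PgeM. Qed.

Lemma PgeC k c : vge v c k -> Pge k c%:P.
Proof. by move=> hc i; rewrite coefC; case: eqP => // _; apply: vge0. Qed.

Lemma PgeXn n : Pge 0 'X^n.
Proof. by move=> i; rewrite coefXn; case: eqP => _; [apply: vge1|apply: vge0]. Qed.

Lemma PgeX p n : Pge 0 p -> Pge 0 (p ^+ n).
Proof.
move=> hp; elim: n => [|n IH]; first by apply: PgeC; apply: vge1.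
by rewrite exprS; apply: PgeMl.
Qed.

Lemma Pge_all0 p : (forall n : nat, Pge n%:Z p) -> p = 0.
Proof. by move=> h; apply/polyP => i; rewrite coef0; apply: vge_all0 => n; apply: h. Qed.

(** Long division by a monic polynomial never divides coefficients, so it cannot lower the
    valuation. *)
Lemma Pge_divmod k g p : g \is monic -> Pge 0 g -> Pge k p ->
  Pge k (p %/ g) /\ Pge k (p %% g).
Proof.
move=> gm hg; have g0 := monic_neq0 gm.
suff H n : forall p : {poly K}, (size p <= n)%N -> Pge k p ->
    exists q r, [/\ p = q * g + r, (size r < size g)%N, Pge k q & Pge k r].
  move=> /(H _ _ (leqnn _))[q [r [-> sr hq hr]]].
  by rewrite divp_addl_mul_small // modp_addl_mul_small.
elim: n => [|n IH] {}p sp hp.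
  exists 0, p; split=> //; [by rewrite mul0r add0r| |exact: Pge0].
  by move: sp; rewrite leqn0 => /eqP->; rewrite size_poly_gt0.
have [lt|le] := ltnP (size p) (size g).
  by exists 0, p; split=> //; [rewrite mul0r add0r|exact: Pge0].
have p0 : p != 0 by rewrite -size_poly_gt0; apply: leq_trans le; rewrite size_poly_gt0.
pose t := (lead_coef p)%:P * 'X^(size p - size g).
have ht : Pge k t by apply: PgeMr; [apply: PgeC; apply: hp|apply: PgeXn].
have st : (size (p - t * g)%R <= n)%N.
  rewrite -ltnS; apply: leq_trans sp; rewrite ltnNge; apply/negP => ge.
  have st : size (t * g) = size p.
    rewrite /t -mulrA size_Cmul ?lead_coef_eq0 // size_Mmonic ?monic_neq0 ?monicXn //.
    by rewrite size_polyXn addSn /= subnK.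
  have sz : size (p - t * g) = size p.
    by apply/eqP; rewrite eqn_leq ge andbT (leq_trans (size_polyD _ _)) // size_polyN // st maxnn.
  have : lead_coef (p - t * g) == 0.
    rewrite lead_coefE sz coefB -{2}st -!lead_coefE.
    rewrite lead_coef_Mmonic // /t mul_polyC lead_coefZ (monicP (monicXn _ _)).
    by rewrite mulr1 subrr.
  by rewrite lead_coef_eq0 -size_poly_eq0 sz size_poly_eq0 (negPf p0).
have [|q [r [e sr hq hr]]] := IH _ st.
  by apply: PgeB => //; apply: PgeMr.
exists (q + t), r; split=> //; last exact: PgeD.
by rewrite mulrDl addrAC -e subrK.
Qed.

Lemma divmodp_polyXn (p : {poly K}) m :
  drop_poly m p = p %/ 'X^m /\ take_poly m p = p %% 'X^m.
Proof.
apply: divp_modpP; first by rewrite addrC poly_take_drop.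
by rewrite size_polyXn ltnS size_take_poly.
Qed.

(** * Splitting off the factor of f that reduces to X^m *)

Section Factor.
Hypothesis hc : v_complete v.
Variables (f : {poly K}) (m : nat).
Hypotheses (f0 : Pge 0 f) (flow : forall i, (i < m)%N -> vge v f`_i 1).
Hypothesis fm : f`_m != 0 /\ v f`_m = 0.

Let q0 := f %/ 'X^m.
Let n0 : {poly K} := 1 - (f`_m)^-1%:P * q0.
Let s : {poly K} := (f`_m)^-1%:P * \sum_(i < m) n0 ^+ i.

Let q0_coef i : q0`_i = f`_(i + m).
Proof.
by rewrite /q0 -(proj1 (divmodp_polyXn f m)) coef_drop_poly.
Qed.

Let fmV : Pge 0 (f`_m)^-1%:P.
Proof. by apply: PgeC; case: fm => a b; right; rewrite val_inv // b. Qed.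

Let n00 : Pge 0 n0.
Proof.
apply: PgeB; first by apply: PgeC; apply: vge1.
by apply: PgeMl => // i; rewrite q0_coef; apply: f0.
Qed.

Let s0 : Pge 0 s.
Proof.
apply: PgeMl => //; apply: (big_ind (Pge 0)); [exact: Pge0|exact: PgeD|].
by move=> i _; apply: PgeX.
Qed.

(* n0 has constant term 0, so s inverts q0 modulo X^m by the geometric series *)
Let q0s : exists h, Pge 0 h /\ 1 - q0 * s = h * 'X^m.
Proof.
have : ('X %| n0).
  rewrite -(subr0 'X) -polyC0 dvdp_XsubCl /root horner_coef0 /n0 coefB coef1 coefCM.
  by rewrite q0_coef add0n mulVf ?subrr //; case: fm.
move=> /dvdpP[h e].
have hge : Pge 0 h.
  by move=> i; have := n00 i.+1; rewrite e coefMX.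
exists (h ^+ m); split; first exact: PgeX.
rewrite -exprMn -e /s mulrCA mulrA.
have -> : (f`_m)^-1%:P * q0 = 1 - n0 by rewrite /n0; ring.
have E : n0 ^+ m - 1 = (n0 - 1) * \sum_(i < m) n0 ^+ i by rewrite subrX1.
by rewrite -(opprB n0) mulNr -E; ring.
Qed.

Let step g := g + (s * (f %% g)) %% g.
Let inv (k : nat) g := [/\ g \is monic, size g = m.+1, Pge 1 (g - 'X^m)
  & Pge k.+1%:Z (f %% g)].

(** Write f = q g + r, s r = u g + d and 1 - q s = h g + w; since g is X^m and q is [q0] modulo the
    maximal ideal, w vanishes there. The new remainder is that of r w - d (r h + q u): the first
    term gains one power of the uniformizer from w, the second is quadratically small. *)
Let inv_step k g : inv k g -> inv k.+1 (step g) /\ Pge k.+1%:Z (step g - g).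
Proof.
move=> [gm sg gX hr].
have g0 : g != 0 by apply: monic_neq0.
have hg : Pge 0 g.
  by rewrite -[g](subrK 'X^m); apply: PgeD; [apply: Pge_le gX|apply: PgeXn].
set r := f %% g in hr *; set q := f %/ g.
have ef : f = q * g + r by apply: divp_eq.
have hq : Pge 0 q by case: (Pge_divmod gm hg f0).
have hr0 : Pge 0 r by apply: Pge_le hr.
have [hu hd] : Pge k.+1%:Z ((s * r) %/ g) /\ Pge k.+1%:Z ((s * r) %% g).
  by apply: Pge_divmod => //; apply: PgeMl.
set u := _ %/ g in hu; set d := _ %% g in hd.
have esr : s * r = u * g + d by apply: divp_eq.
have st : step g = g + d by [].
have sd : (size d < size g)%N by rewrite ltn_modp.
have sg' : size (step g) = m.+1 by rewrite st size_polyDl // sg.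
have gm' : step g \is monic.
  by rewrite monicE st lead_coefDl // -monicE.
have hg' : Pge 0 (step g) by rewrite st; apply: PgeD => //; apply: Pge_le hd.
(* Multiplied by X^m, both quotients agree with f modulo the maximal ideal. *)
have hqq : Pge 1 (q - q0).
  have hX : Pge 1 ((q - q0) * 'X^m).
    have -> : (q - q0) * 'X^m = (f %% 'X^m) - r - q * (g - 'X^m).
      rewrite [f %% _](_ : _ = f - q0 * 'X^m); last first.
        by rewrite [in RHS](divp_eq f 'X^m) addrC addKr.
      by rewrite ef; ring.
    apply: PgeB; last exact: PgeMl.
    apply: PgeB; last by apply: Pge_le hr.
    rewrite -(proj2 (divmodp_polyXn f m)).
    by move=> i; rewrite coef_take_poly; case: ifP => [/flow//|_]; apply: vge0.
  by move=> i; have := hX (i + m)%N; rewrite coefMXn ltnNge leq_addl /= addnK.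
have [h [hh eh]] := q0s.
have [w [hw ew]] : exists w, Pge 1 w /\ 1 - q * s = h * g + w.
  exists (- (h * (g - 'X^m)) - (q - q0) * s); split.
    by apply: PgeB; [apply: PgeN; apply: PgeMl|apply: PgeMr].
  have -> : q * s = (q - q0) * s + q0 * s by rewrite -mulrDl subrK.
  have -> : q0 * s = 1 - h * 'X^m by rewrite -eh opprB addrC subrK.
  ring.
have er : f = (q + (r * h + q * u)) * step g + (r * w - d * (r * h + q * u)).
  have E : r - q * d = g * (r * h + q * u) + r * w.
    have -> : d = s * r - u * g by rewrite esr addrC addKr.
    have -> : r - q * (s * r - u * g) = r * (1 - q * s) + q * u * g by ring.
    by rewrite ew; ring.
  have -> : f = q * step g + (r - q * d) by rewrite {1}ef st; ring.
  by rewrite E st; ring.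
split; last by rewrite st addrC addKr.
split=> //.
  rewrite st addrAC; apply: PgeD => //; apply: Pge_le hd; lia.
rewrite er modpD modp_mull add0r.
apply: (proj2 (Pge_divmod gm' hg' _)).
apply: PgeB.
  have -> : k.+2%:Z = k.+1%:Z + 1 by lia.
  exact: PgeM.
apply: (@Pge_le _ (k.+1%:Z + k.+1%:Z)); first by lia.
apply: PgeM => //; apply: PgeD; first exact: PgeMr.
exact: PgeMl.
Qed.

Let gk := fix gk k := if k is k'.+1 then step (gk k') else 'X^m.

Let inv_gk k : inv k (gk k).
Proof.
elim: k => [|k /inv_step[]//]; split=> /=; rewrite ?size_polyXn ?monicXn //.
  by rewrite subrr; apply: Pge0.
rewrite -(proj2 (divmodp_polyXn f m)).
by move=> i; rewrite coef_take_poly; case: ifP => [/flow//|_]; apply: vge0.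
Qed.

Let gk_cauchy k l : (k <= l)%N -> Pge k.+1%:Z (gk l - gk k).
Proof.
move=> /subnK<-; elim: (l - k)%N => [|j IH]; first by rewrite subrr; apply: Pge0.
rewrite addSn -[_ - _](subrKA (gk (j + k))); apply: PgeD => //=.
by case: (inv_step (inv_gk (j + k))) => _; apply: Pge_le; lia.
Qed.

(* Hensel's lemma for the factor X^m of the reduction of f: replace an approximate factor
   g by g + (s (f mod g) mod g), where s inverts the cofactor modulo X^m. *)
Lemma hensel_factor : exists g, [/\ g \is monic, size g = m.+1 & g %| f].
Proof.
have cau (i : 'I_m) : v_cauchy v (fun k => (gk k)`_i).
  move=> N; exists `|N|%N => k l hk hl.
  have key a b : (`|N| <= a)%N -> (a <= b)%N -> vge v ((gk b)`_i - (gk a)`_i) N.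
    by move=> Na ab; rewrite -coefB; apply: vge_le (gk_cauchy ab i); lia.
  have [kl|lk] := leqP k l; last by apply: key => //; apply: ltnW.
  by rewrite -opprB; apply: vgeN; apply: key.
have [l hl] := fin_all_exists (fun i => hc (cau i)).
pose g : {poly K} := 'X^m + \poly_(i < m) (if insub i is Some j then l j else 0).
have sl : (size (\poly_(i < m) (if insub i is Some j then l j else 0))%R < size ('X^m : {poly K})%R)%N.
  by rewrite size_polyXn ltnS size_poly.
have sg : size g = m.+1 by rewrite size_polyDl // size_polyXn.
have gm : g \is monic by rewrite monicE lead_coefDl // -monicE monicXn.
have glim k : Pge k.+1%:Z (gk k - g).
  move=> i; rewrite coefB.
  have [km sk kX _] := inv_gk k.
  have [im|mi] := ltnP i m; last first.
    have [->|ne] := eqVneq i m.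
      have e : forall p : {poly K}, p \is monic -> size p = m.+1 -> p`_m = 1.
        by move=> p /monicP; rewrite lead_coefE => + e; rewrite e.
      by rewrite !e // subrr; apply: vge0.
    have lt : (m < i)%N by rewrite ltn_neqAle eq_sym ne.
    by rewrite !nth_default ?subr0 ?sg ?sk //; apply: vge0.
  rewrite coefD coefXn (ltn_eqF im) add0r coef_poly im insubT /=.
  have [M hM] := hl (Ordinal im) k.+1%:Z.
  have h1 := hM (maxn M k) (leq_maxl _ _).
  have := gk_cauchy (leq_maxr M k) i; rewrite coefB => h2.
  by have := vgeB h1 h2; rewrite /= opprB [_ - l _ + _]addrC addrA subrK.
have hg : Pge 0 g.
  have -> : g = 'X^m - (gk 0 - g) by rewrite /= opprB addrC subrK.
  by apply: PgeB; [apply: PgeXn|apply: Pge_le (glim 0)].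
(* The remainder of f by g equals that of a multiple of [gk k - g] plus [f %% gk k], both
   arbitrarily small. *)
exists g; split=> //; apply/modp_eq0P; apply: Pge_all0 => k.
have [km sk kX hk] := inv_gk k.
have hkg : Pge 0 (gk k).
  by rewrite -[gk k](subrK 'X^m); apply: PgeD; [apply: Pge_le kX|apply: PgeXn].
have -> : f = (f %/ gk k) * g + ((f %/ gk k) * (gk k - g) + f %% gk k).
  by rewrite {1}(divp_eq f (gk k)); ring.
rewrite modpD modp_mull add0r; apply: (proj2 (Pge_divmod gm hg _)).
have [hq _] := Pge_divmod km hkg f0.
apply: PgeD; last by apply: Pge_le hk; lia.
by apply: PgeMl => //; apply: Pge_le (glim k); lia.
Qed.

End Factor.
End Valuation.

(** * The integral closure in a finite extension *)

Section Integral.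
Variables (K : fieldType) (v : K -> int).
Hypothesis hv : is_discrete_valuation v.

(** Scale p so that the least valuation of its coefficients is 0. If neither end attained it, the
    first index m that does would lie strictly between them, and Hensel's lemma would give a factor
    of degree m. *)
Lemma irreducible_ends (p : {poly K}) : v_complete v ->
    irreducible_poly p -> p`_0 != 0 ->
  (forall i, valring v (p`_i / lead_coef p)) \/ (forall i, valring v (p`_i / p`_0)).
Proof.
move=> hc [p1 pirr] p00.
have hV : valuation_ring (valring v) := valring_valuation hv.
have pn0 : p != 0 by rewrite -size_poly_gt0; apply: ltnW.
have l0 : lead_coef p != 0 by rewrite lead_coef_eq0.
have mem i : p`_i != 0 -> p`_i \in (p : seq K).
  by move=> pi; apply/mem_nth; rewrite ltnNge; apply: contra pi => /leq_sizeP->.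
have [|c [cp c0 hcp]] := vr_seq_divisor hV (s := p).
  by exists (p`_0) => //; apply: mem.
have hci i : valring v (p`_i / c).
  have [->|pi] := eqVneq p`_i 0; first by rewrite mul0r; apply: vge0.
  by apply: hcp; apply: mem.
have unit_case d : d != 0 -> ~ vge v (d / c) 1 -> forall i, valring v (p`_i / d).
  move=> d0 nd i.
  have -> : p`_i / d = (p`_i / c) * (d / c)^-1 by rewrite invf_div; field; rewrite d0 c0.
  apply: vrM => //.
  have dc : d / c != 0 by rewrite mulf_neq0 ?invr_eq0.
  by move: nd; rewrite /valring !vgeE ?invr_eq0 // val_inv //; lia.
case: (classic (vge v (lead_coef p / c) 1)) => [hl|]; last by left; apply: unit_case.
case: (classic (vge v (p`_0 / c) 1)) => [h0|]; last by right; apply: unit_case.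
exfalso.
pose f := c^-1 *: p.
have fE i : f`_i = p`_i / c by rewrite coefZ mulrC.
have fp g : (g %| f) = (g %| p) by rewrite dvdpZr // invr_eq0.
clearbody f.
have f0 : Pge v 0 f by move=> i; rewrite fE; apply: hci.
have exm : exists i, (f`_i != 0) && (v f`_i < 1%:Z).
  have [i ip ci] := nthP 0 cp; exists i.
  by rewrite fE ci divff // oner_neq0 (val_one hv).
case: (ex_minnP exm) => m /andP[fm0 fm1] mmin.
have flow i : (i < m)%N -> vge v f`_i 1.
  move=> im; have [->|fi0] := eqVneq f`_i 0; first exact: vge0.
  rewrite vgeE // leNgt; apply/negP => fi1.
  by have := mmin i; rewrite fi0 fi1 leqNgt im => /(_ isT).
have fm : f`_m != 0 /\ v f`_m = 0.
  split=> //; have := f0 m; rewrite vgeE // => h; move: (v f`_m) h fm1 => a; clear; lia.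
have [g [gm sg gf]] := hensel_factor hv hc f0 flow fm.
have gp : g %| p by rewrite -fp.
have m0 : m != 0%N.
  by apply/eqP => e; move: h0; rewrite -fE -e vgeE // (proj2 fm).
have := pirr g; rewrite sg eqSS => /(_ m0 gp) /eqp_size; rewrite sg => sp.
by move: hl; rewrite lead_coefE -fE -sp /= vgeE // (proj2 fm).
Qed.

Variable (L : fieldExtType K).

(** Apply [irreducible_ends] to the minimal polynomial over K. Normalized at its leading end it
    shows that x is integral; normalized at its constant end and reversed, it does so for x^-1. *)
Lemma int_closure_total (hc : v_complete v) (x : L) :
  int_closure v x \/ int_closure v x^-1.
Proof.
have [->|x0] := eqVneq x 0.
  left; exists 'X; split; rewrite ?monicX //.
    by move=> i; rewrite coefX; case: eqP => _; [apply: vge1|apply: vge0].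
  by rewrite map_polyX /root hornerX.
have /polyOver1P[p pE] := minPolyOver 1%AS x.
have rp : root (map_poly (in_alg L) p) x by rewrite -pE root_minPoly.
have pn0 : p != 0.
  by rewrite -(map_poly_eq0 (in_alg L)) -pE monic_neq0 // monic_minPoly.
have pirr : irreducible_poly p.
  split.
    rewrite -(size_map_poly (in_alg L)) -pE size_minPoly ltnS.
    by rewrite adjoin_degreeE divn_gt0 ?adim_gt0 // dimvS // subv_adjoin.
  move=> q q1 qp.
  have := minPoly_irr (K := 1%AS) (x := x) (p := map_poly (in_alg L) q).
  rewrite pE dvdp_map qp -size_poly_eq1 size_map_poly (negPf q1) orbF.
  by rewrite eqp_map; apply=> //; apply/polyOver1P; exists q.
have p00 : p`_0 != 0.
  apply/eqP => p0.
  have /pirr.2 : ('X %| p) by rewrite -(subr0 'X) -polyC0 dvdp_XsubCl /root horner_coef0 p0.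
  rewrite size_polyX => /(_ isT) e.
  have : root (map_poly (in_alg L) 'X) x.
    by rewrite (eqp_root (q := map_poly (in_alg L) p)) // eqp_map.
  by rewrite map_polyX /root hornerX (negPf x0).
have l0 : lead_coef p != 0 by rewrite lead_coef_eq0.
case: (irreducible_ends hc pirr p00) => H; [left|right].
  exists ((lead_coef p)^-1 *: p); split.
  - by rewrite monicE lead_coefZ mulVf.
  - by move=> i; rewrite coefZ mulrC.
  - by rewrite map_polyZ rootZ // fmorph_eq0 invr_eq0.
set n := (size p).-1.
have sp : size p = n.+1 by rewrite prednK // size_poly_gt0.
pose q := \poly_(i < n.+1) (p`_(n - i) / p`_0).
exists q; split.
- rewrite monicE lead_coefE size_poly_eq /= ?subnn ?divff ?oner_neq0 //.
  by rewrite coef_poly ltnSn subnn divff.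
- by move=> i; rewrite coef_poly; case: ifP => // _; apply: vge0.
- have sq : (size (map_poly (in_alg L) q) <= n.+1)%N.
    by rewrite size_map_poly size_poly.
  have sp' : (size (map_poly (in_alg L) p) <= n.+1)%N by rewrite size_map_poly sp.
  have E : x ^+ n * (map_poly (in_alg L) q).[x^-1] =
      in_alg L (p`_0)^-1 * (map_poly (in_alg L) p).[x].
    rewrite (horner_coef_wide _ sq) (horner_coef_wide _ sp') !mulr_sumr.
    rewrite (reindex_inj rev_ord_inj) /=; apply: eq_bigr => i _.
    have ni : (i <= n)%N by rewrite -ltnS.
    rewrite !coef_map coef_poly subSS ltnS leq_subr subKn //.
    change (x ^+ n * (in_alg L (p`_i * (p`_0)^-1) * x^-1 ^+ (n - i)) =
      in_alg L (p`_0)^-1 * (in_alg L p`_i * x ^+ i)).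
    rewrite (rmorphM (in_alg L)) exprVn.
    set a : L := in_alg L p`_i; set b : L := in_alg L (p`_0)^-1.
    change (x ^+ n * (a * b * (x ^+ (n - i))^-1) = b * (a * x ^+ i)).
    have -> : x ^+ n = x ^+ i * x ^+ (n - i) by rewrite -exprD subnKC.
    have xn0 : x ^+ (n - i) != 0 by rewrite expf_neq0.
    move: (x ^+ (n - i)) (x ^+ i) a b xn0 => y z a b y0.
    by field.
  apply/eqP; have : x ^+ n != 0 by rewrite expf_neq0.
  move=> /mulfI; apply; rewrite E mulr0.
  by move/rootP: rp => ->; rewrite mulr0.
Qed.

(** A boolean form of [valring], so that the valuation ring becomes a ring type and the theory of
    [integralOver] gives closure under subtraction and product. *)
Definition valring_pred : {pred K} := fun x => (x == 0) || (0 <= v x).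

Lemma valringP x : reflect (valring v x) (x \in valring_pred).
Proof.
apply: (iffP orP) => [[/eqP->|h]|[->|h]]; [exact: vge0|by right|by left|by right].
Qed.

Lemma valring_subring : subring_closed valring_pred.
Proof.
have [h1 hB hM _] := valring_valuation hv.
split; first exact/valringP.
- by move=> x y /valringP hx /valringP hy; apply/valringP; apply: hB.
- by move=> x y /valringP hx /valringP hy; apply/valringP; apply: hM.
Qed.

HB.instance Definition _ := GRing.isSubringClosed.Build K valring_pred valring_subring.

Record valring_type := ValringType { valring_val :> K; _ : valring_val \in valring_pred }.
HB.instance Definition _ := [isSub for valring_val].
HB.instance Definition _ := [Choice of valring_type by <:].
HB.instance Definition _ := [SubChoice_isSubComNzRing of valring_type by <:].

Let emb : valring_type -> L := in_alg L \o \val.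

Lemma int_closureE (x : L) : int_closure v x <-> integralOver emb x.
Proof.
have mv (q : {poly valring_type}) : (map_poly val q : {poly K})  \is monic = (q \is monic).
  by rewrite !monicE (lead_coef_map_inj val_inj (rmorph0 _)) -val_eqE.
split=> [[p [pm hp rp]]|[q qm rq]].
  pose q : {poly valring_type} := \poly_(i < size p) insubd 0 p`_i.
  have qp : map_poly val q = p.
    apply/polyP => i; rewrite coef_map coef_poly; case: ltnP => h.
      by rewrite /= insubdK //; apply/valringP.
    by rewrite nth_default.
  exists q; first by rewrite -mv qp.
  by rewrite map_poly_comp qp.
exists (map_poly val q); split; first by rewrite mv.
  by move=> i; rewrite coef_map; apply/valringP; apply: (valP q`_i).
by move: rq; rewrite map_poly_comp.
Qed.

Lemma int_closure_valuation_ring : v_complete v ->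
  valuation_ring (@int_closure K v L).
Proof.
move=> hc; split; last exact: int_closure_total.
- by apply/int_closureE; apply: integral1.
- by move=> x y /int_closureE hx /int_closureE hy; apply/int_closureE; apply: integral_sub.
- by move=> x y /int_closureE hx /int_closureE hy; apply/int_closureE; apply: integral_mul.
Qed.

(** Valuation rings are integrally closed: when x^-1 is in O, dividing the equation of x, of degree
    n + 1, by x^n writes x as a polynomial in x^-1 over O. *)
Lemma int_closure_in_alg (x : K) : int_closure v (in_alg L x) <-> valring v x.
Proof.
split=> [[p [pm hp]]|hx]; last first.
  exists ('X - x%:P); split; rewrite ?monicXsubC //.
    move=> i; rewrite coefB coefX coefC; apply: vgeB => //.
      by case: eqP => _; [apply: vge1|apply: vge0].
    by case: eqP => _ //; apply: vge0.
  by rewrite rmorphB /= map_polyX map_polyC /= root_XsubC.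
rewrite fmorph_root => /rootP rp.
have [h1 hB hM ht] := valring_valuation hv.
case: (ht x) => // hV.
have [->|x0] := eqVneq x 0; first exact: vge0.
have [n sp] : exists n, size p = n.+1.
  by exists (size p).-1; rewrite prednK // size_poly_gt0 monic_neq0.
have pn : p`_n = 1 by move/monicP: pm; rewrite lead_coefE sp.
move: rp; rewrite horner_coef sp big_ord_recr /= pn mul1r => rp.
case: n sp pn rp => [|n] sp pn rp.
  by move: rp; rewrite big_ord0 expr0 add0r => /eqP; rewrite (oner_eq0 K).
have -> : x = - \sum_(i < n.+1) p`_i * x^-1 ^+ (n - i).
  have xn : x ^+ n != 0 by rewrite expf_neq0.
  have S : (\sum_(i < n.+1) p`_i * x^-1 ^+ (n - i)) * x ^+ n =
      \sum_(i < n.+1) p`_i * x ^+ i.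
    rewrite mulr_suml; apply: eq_bigr => i _.
    have ni : (i <= n)%N by rewrite -ltnS.
    rewrite -mulrA; congr (_ * _).
    have -> : x ^+ n = x ^+ i * x ^+ (n - i) by rewrite -exprD subnKC.
    by rewrite exprVn mulrCA mulVf ?mulr1 // expf_neq0.
  by apply: (mulIf xn); rewrite -exprS mulNr S; apply/eqP; rewrite -addr_eq0 addrC rp.
apply: vgeN => //; apply: vge_sum => // i _; apply: (hM) => //.
by elim: (n - i)%N => [|j IH]; rewrite ?expr0 // exprS; apply: hM.
Qed.

End Integral.

(** * Orders of two by two matrices over a valuation ring *)

Section Matrix2.
Variable F : fieldType.

Definition mx2 (a b c d : F) : 'M[F]_2 :=
  \matrix_(i, j) if i == 0 then (if j == 0 then a else b) else (if j == 0 then c else d).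

Lemma ord2P (i : 'I_2) : i = 0 \/ i = 1.
Proof. by case: i => [[|[|//]] h]; [left|right]; apply: val_inj. Qed.

Lemma mx2_00 a b c d : mx2 a b c d 0 0 = a. Proof. by rewrite mxE. Qed.
Lemma mx2_01 a b c d : mx2 a b c d 0 1 = b. Proof. by rewrite mxE. Qed.
Lemma mx2_10 a b c d : mx2 a b c d 1 0 = c. Proof. by rewrite mxE. Qed.
Lemma mx2_11 a b c d : mx2 a b c d 1 1 = d. Proof. by rewrite mxE. Qed.
Definition mx2_entries := (mx2_00, mx2_01, mx2_10, mx2_11).

Lemma mx2E (g : 'M[F]_2) : g = mx2 (g 0 0) (g 0 1) (g 1 0) (g 1 1).
Proof.
by apply/matrixP => i j; case: (ord2P i) => ->; case: (ord2P j) => ->; rewrite mx2_entries.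
Qed.

Lemma mx2P (g h : 'M[F]_2) : g 0 0 = h 0 0 -> g 0 1 = h 0 1 -> g 1 0 = h 1 0 ->
  g 1 1 = h 1 1 -> g = h.
Proof. by move=> e1 e2 e3 e4; rewrite (mx2E g) (mx2E h) e1 e2 e3 e4. Qed.

Lemma mx2_inj a b c d a' b' c' d' :
  mx2 a b c d = mx2 a' b' c' d' -> [/\ a = a', b = b', c = c' & d = d'].
Proof.
by move=> e; split; [have := congr1 (fun m : 'M_2 => m 0 0) e|have := congr1 (fun m : 'M_2 => m 0 1) e
  |have := congr1 (fun m : 'M_2 => m 1 0) e|have := congr1 (fun m : 'M_2 => m 1 1) e]; rewrite !mx2_entries.
Qed.

Lemma mx2M a b c d a' b' c' d' : mx2 a b c d * mx2 a' b' c' d' =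
  mx2 (a * a' + b * c') (a * b' + b * d') (c * a' + d * c') (c * b' + d * d').
Proof.
by apply: mx2P; rewrite mx2_entries mxE big_ord_recl big_ord1 ?lift0E
  (_ : lift ord0 ord0 = 1 :> 'I_2) ?mx2_entries //; apply: val_inj.
Qed.

Lemma mx2D a b c d a' b' c' d' : mx2 a b c d + mx2 a' b' c' d' =
  mx2 (a + a') (b + b') (c + c') (d + d').
Proof. by apply: mx2P; rewrite mxE !mx2_entries. Qed.

Lemma mx2N a b c d : - mx2 a b c d = mx2 (- a) (- b) (- c) (- d).
Proof. by apply: mx2P; rewrite mxE !mx2_entries. Qed.

Lemma mx2B a b c d a' b' c' d' : mx2 a b c d - mx2 a' b' c' d' =
  mx2 (a - a') (b - b') (c - c') (d - d').
Proof. by rewrite mx2N mx2D. Qed.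

Lemma mx2Z k a b c d : k *: mx2 a b c d = mx2 (k * a) (k * b) (k * c) (k * d).
Proof. by apply: mx2P; rewrite mxE !mx2_entries. Qed.

Lemma mx2C k : k%:M = mx2 k 0 0 k.
Proof. by apply: mx2P; rewrite mxE !mx2_entries. Qed.

Lemma mx2_1 : 1 = mx2 1 0 0 1.
Proof. by rewrite -mx2C. Qed.

Lemma mx2_tr a b c d : \tr (mx2 a b c d) = a + d.
Proof.
by rewrite /mxtrace big_ord_recl big_ord1 (_ : lift ord0 ord0 = 1 :> 'I_2) ?mx2_entries //;
  apply: val_inj.
Qed.

Lemma mx2_det a b c d : \det (mx2 a b c d) = a * d - b * c.
Proof.
rewrite (expand_det_row _ 0) big_ord_recl big_ord1 /cofactor !det_mx11 !mxE /=.
by rewrite expr0 expr1 mul1r mulN1r mulrN.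
Qed.

Lemma mx2_unit a b c d : (mx2 a b c d \is a GRing.unit) = (a * d - b * c != 0).
Proof. by rewrite -[LHS]/(mx2 a b c d \in unitmx) unitmxE mx2_det unitfE. Qed.

Lemma mx_unitM (P Q : 'M[F]_2) :
  (P * Q \is a GRing.unit) = (P \is a GRing.unit) && (Q \is a GRing.unit).
Proof. exact: unitmx_mul. Qed.

Lemma mx_inv_eq (P Q : 'M[F]_2) : Q * P = 1 -> P^-1 = Q.
Proof.
move=> e; have u : P \is a GRing.unit by have [] := mulmx1_unit e.
by rewrite -[Q]mulr1 -(mulrV u) mulrA e mul1r.
Qed.

Lemma mx_conjK (P x : 'M[F]_2) : P \is a GRing.unit -> P * (P^-1 * x * P) * P^-1 = x.
Proof. by move=> uP; rewrite !mulrA mulrV // mul1r mulrK. Qed.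

Lemma mx_conjVK (P x : 'M[F]_2) : P \is a GRing.unit -> P^-1 * (P * x * P^-1) * P = x.
Proof. by move=> uP; rewrite !mulrA mulVr // mul1r mulrVK. Qed.

Definition mx2_simp := (mx2M, mx2D, mx2B, mx2N, mx2Z, mx2C).

End Matrix2.

Lemma map_mx2 (F G : fieldType) (f : F -> G) a b c d :
  map_mx f (mx2 a b c d) = mx2 (f a) (f b) (f c) (f d).
Proof. by apply: mx2P; rewrite !mxE. Qed.

(** * Orders and the conjugates of the matrix ring over a valuation ring *)

Section Orders.
Variables (F : fieldType) (V : F -> Prop).
Hypothesis hV : valuation_ring V.

Definition mxV (g : 'M[F]_2) : Prop := forall i j, V (g i j).

Lemma mxV_mx2 a b c d : mxV (mx2 a b c d) <-> [/\ V a, V b, V c & V d].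
Proof.
split=> [h|[ha hb hc hd] i j].
  by split; [have := h 0 0|have := h 0 1|have := h 1 0|have := h 1 1]; rewrite mx2_entries.
by case: (ord2P i) => ->; case: (ord2P j) => ->; rewrite mx2_entries.
Qed.

Lemma mxVD g h : mxV g -> mxV h -> mxV (g + h).
Proof. by move=> hg hh i j; rewrite mxE; apply: (vrD hV). Qed.

Lemma mxVB g h : mxV g -> mxV h -> mxV (g - h).
Proof. by move=> hg hh i j; rewrite !mxE; apply: (vrB hV). Qed.

Lemma mxVN g : mxV g -> mxV (- g).
Proof. by move=> hg i j; rewrite !mxE; apply: (vrN hV). Qed.

Lemma mxVM g h : mxV g -> mxV h -> mxV (g * h).
Proof. by move=> hg hh i j; rewrite !mxE; apply: (vr_sum hV) => k _; apply: (vrM hV). Qed.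

Lemma mxVZ k g : V k -> mxV g -> mxV (k *: g).
Proof. by move=> hk hg i j; rewrite !mxE; apply: (vrM hV). Qed.

Lemma mxVC k : V k -> mxV k%:M.
Proof. by move=> hk; rewrite mx2C; apply/mxV_mx2; split=> //; apply: (vr0 hV). Qed.

Lemma mxV1 : mxV 1.
Proof. by apply: mxVC; apply: (vr1 hV). Qed.

Lemma mxV0 : mxV 0.
Proof. by move=> i j; rewrite mxE; apply: (vr0 hV). Qed.

Lemma mxV_sum (I : Type) (r : seq I) (P : pred I) (G : I -> 'M[F]_2) :
  (forall i, P i -> mxV (G i)) -> mxV (\sum_(i <- r | P i) G i).
Proof. by move=> h; apply: (big_ind mxV) => //; [apply: mxV0|apply: mxVD]. Qed.

Lemma mxV_delta i j : mxV (delta_mx i j).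
Proof. by move=> k l; rewrite mxE; case: (_ && _); [apply: (vr1 hV)|apply: (vr0 hV)]. Qed.

Lemma O_spanP s x : O_span V s x <-> exists c : nat -> F, (forall i, V (c i)) /\
  x = \sum_(i < size s) c i *: s`_i.
Proof.
split=> [[c [hc ->]]|[c [hc ->]]]; last by exists (fun i => c i).
exists (fun i => if insub i is Some j then c j else 0); split.
  by move=> i; case: insubP => [j _ _|_]; [apply: hc|apply: (vr0 hV)].
apply: eq_bigr => i _; rewrite (insubT (fun k => k < size s)%N (ltn_ord i)) /=.
by congr (c _ *: _); apply: val_inj.
Qed.

Lemma O_span_nth s i : O_span V s s`_i.
Proof.
apply/O_spanP; exists (fun k => (k == i)%:R); split.
  by move=> k; case: eqP => _; [apply: (vr1 hV)|apply: (vr0 hV)].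
have [lt|ge] := ltnP i (size s).
  rewrite (bigD1 (Ordinal lt)) //= eqxx scale1r big1 ?addr0 // => k /eqP ne.
  by case: eqP => [e|_]; [case: ne; apply: val_inj|rewrite scale0r].
rewrite nth_default // big1 // => k _; case: eqP => [e|_]; last by rewrite scale0r.
by move: (ltn_ord k); rewrite e ltnNge ge.
Qed.

Lemma order_scale X : is_order V X -> forall k x, V k -> X x -> X (k *: x).
Proof.
case=> _ _ _ _ [s hs] k x hk /hs/O_spanP[c [hc ->]].
apply/hs/O_spanP; exists (fun i => k * c i); split; first by move=> i; apply: (vrM hV).
by rewrite scaler_sumr; apply: eq_bigr => i _; rewrite scalerA.
Qed.

Lemma order_scalar X : is_order V X -> forall k, V k -> X k%:M.
Proof. by move=> hX k hk; rewrite -scalemx1; apply: order_scale => //; case: hX. Qed.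

Definition conjM (P : 'M[F]_2) (x : 'M[F]_2) : Prop := mxV (P^-1 * x * P).

(* Hermite normal form of the lattice spanned by the columns of the elements of X *)
Lemma order_in_conj X : is_order V X ->
  exists2 P, P \is a GRing.unit & forall x, X x -> conjM P x.
Proof.
move=> hX; case: (hX) => X1 XD XN XM [s hs].
have sX g : g \in s -> X g.
  by move=> /(nthP 0)[i _ <-]; apply/hs/O_span_nth.
have [c1 [hc1 e1]] : exists c : nat -> F, (forall i, V (c i)) /\
    1 = \sum_(i < size s) c i *: s`_i by apply/O_spanP/hs.
have mem (i : 'I_(size s)) : s`_i \in s by apply/mem_nth.
(* Look for a column (p1, p2) whose bottom entry divides every bottom entry. Not all of these
   vanish, since 1 is a combination of the generators. *)
have [] := @vr_seq_divisor _ _ hV [seq (g : 'M[F]_2) 1 j | g <- s, j <- enum 'I_2].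
  apply: NNPP => no.
  have z (g : 'M[F]_2) j : g \in s -> g 1 j = 0.
    move=> gs; apply/eqP; apply/negPn/negP => n0; apply: no; exists (g 1 j) => //.
    by apply/allpairsP; exists (g, j); rewrite gs mem_enum.
  have : (1 : 'M[F]_2) 1 1 = 0.
    by rewrite e1 summxE big1 // => i _; rewrite mxE z ?mulr0.
  by rewrite mxE; apply/eqP; apply: oner_neq0.
move=> p2 [/allpairsP[[g1 j] /= [g1s _ p2E]] p20 hp2].
have {}hp2 (g : 'M[F]_2) l : g \in s -> V (g 1 l / p2).
  by move=> gs; apply: hp2; apply/allpairsP; exists (g, l); rewrite gs mem_enum.
pose p1 := g1 0 j.
(* Multiples of (p1, p2) clear all bottom entries; q is a top entry that then divides all the
   others. *)
have [] := @vr_seq_divisor _ _ hV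
    [seq (g : 'M[F]_2) 0 l - g 1 l / p2 * p1 | g <- s, l <- enum 'I_2].
  apply: NNPP => no.
  have z (g : 'M[F]_2) l : g \in s -> g 0 l = p1 / p2 * g 1 l.
    move=> gs; apply/eqP; rewrite -subr_eq0; apply/negPn/negP => n0; apply: no.
    exists (g 0 l - g 1 l / p2 * p1); last first.
      by have -> : g 1 l / p2 * p1 = p1 / p2 * g 1 l by ring.
    by apply/allpairsP; exists (g, l); rewrite gs mem_enum.
  have : (1 : 'M[F]_2) 0 0 = p1 / p2 * (1 : 'M[F]_2) 1 0.
    rewrite e1 !summxE mulr_sumr; apply: eq_bigr => i _.
    by rewrite !mxE z //; ring.
  by rewrite !mxE mulr0; apply/eqP; apply: oner_neq0.
move=> q [/allpairsP[[g2 i] /= [g2s _ qE]] q0 hq].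
have {}hq (g : 'M[F]_2) l : g \in s -> V ((g 0 l - g 1 l / p2 * p1) / q).
  by move=> gs; apply: hq; apply/allpairsP; exists (g, l); rewrite gs mem_enum.
pose P := mx2 q p1 0 p2.
have uP : P \is a GRing.unit by rewrite mx2_unit mulr0 subr0 mulf_neq0.
have PV : P^-1 = mx2 q^-1 (- p1 / (q * p2)) 0 p2^-1.
  by apply: mx_inv_eq; rewrite mx2M mx2_1; congr mx2; field; rewrite ?q0 ?p20.
have h1 x : X x -> mxV (P^-1 * x).
  move=> /hs/O_spanP[c [hc ->]]; rewrite mulr_sumr; apply: mxV_sum => k _.
  rewrite -scalerAr; apply: mxVZ => //; set g := s`_k.
  have gs : g \in s by apply: mem.
  rewrite PV (mx2E g) mx2M; apply/mxV_mx2; split.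
  - by have := hq g 0 gs; congr V; field; rewrite q0 p20.
  - by have := hq g 1 gs; congr V; field; rewrite q0 p20.
  - by rewrite mul0r add0r mulrC; apply: hp2.
  - by rewrite mul0r add0r mulrC; apply: hp2.
(* The columns of P are integral combinations of columns of [g1] and [g2], so P = g2 a + g1 b with a
   and b integral. This reduces P^-1 x P to P^-1 (x g2) and P^-1 (x g1), where [h1] applies. *)
pose a : 'M[F]_2 := delta_mx i 0.
pose b : 'M[F]_2 := delta_mx j 1 - (g2 1 i / p2) *: delta_mx j 0.
have PE : P = g2 * a + g1 * b.
  have D (g : 'M[F]_2) k l : g * delta_mx k l = mx2 (if l == 0 then g 0 k else 0)
      (if l == 0 then 0 else g 0 k) (if l == 0 then g 1 k else 0) (if l == 0 then 0 else g 1 k).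
    rewrite (mx2E (delta_mx k l)) {1}(mx2E g) mx2M.
    by case: (ord2P k) => ->; case: (ord2P l) => ->; congr mx2; rewrite !mxE /= ?mulr1n; ring.
  rewrite /a /b mulrBr -scalerAr !D /= !mx2_simp; congr mx2.
  - by rewrite qE /p1; ring.
  - by rewrite /p1; ring.
  - by rewrite -p2E; field.
  - by rewrite -p2E; ring.
exists P => // x Xx.
rewrite /conjM {2}PE mulrDr !mulrA; apply: mxVD.
  apply: mxVM; last exact: mxV_delta.
  by rewrite -mulrA; apply: h1; apply: XM => //; apply: sX.
apply: mxVM; first by rewrite -mulrA; apply: h1; apply: XM => //; apply: sX.
apply: mxVB; first exact: mxV_delta.
by apply: mxVZ; [apply: hp2|apply: mxV_delta].
Qed.

Lemma conjM_order P : P \is a GRing.unit -> is_order V (conjM P).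
Proof.
move=> uP; split.
- by rewrite /conjM mulr1 mulVr //; apply: mxV1.
- by move=> x y hx hy; rewrite /conjM mulrDr mulrDl; apply: mxVD.
- by move=> x hx; rewrite /conjM mulrN mulNr; apply: mxVN.
- move=> x y hx hy; have := mxVM hx hy.
  by rewrite /conjM !mulrA mulrK.
pose E a b c d := P * mx2 a b c d * P^-1.
exists [:: E 1 0 0 0; E 0 1 0 0; E 0 0 1 0; E 0 0 0 1] => x.
rewrite O_spanP; split=> [hx|[c [hc ->]]]; last first.
  rewrite /conjM mulr_sumr mulr_suml; apply: mxV_sum => i _.
  rewrite -scalerAr -scalerAl; apply: mxVZ => //.
  have Z a b c' d : P^-1 * E a b c' d * P = mx2 a b c' d.
    by rewrite /E !mulrA mulVr // mul1r -mulrA mulVr // mulr1.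
  have v1 := vr1 hV; have v0 := vr0 hV.
  by case: i => [[|[|[|[|//]]]] h] /=; rewrite Z; apply/mxV_mx2; split.
set y := P^-1 * x * P in hx.
have xE : x = P * y * P^-1 by rewrite /y !mulrA mulrV // mul1r -mulrA mulrV // mulr1.
exists (fun i => nth 0 [:: y 0 0; y 0 1; y 1 0; y 1 1] i); split.
  move=> i; case: i => [|[|[|[|i]]]] /=; try exact: hx.
  by rewrite nth_nil; apply: (vr0 hV).
have lin k m : k *: (P * m * P^-1) = P * (k *: m) * P^-1 by rewrite -scalerAr -scalerAl.
rewrite {1}xE {1}(mx2E y) !big_ord_recl big_ord0 addr0 /= /E !lin -!mulrDl -!mulrDr.
by congr (_ * _ * _); rewrite !mx2_simp; congr mx2; ring.
Qed.

(** On matrix units the hypothesis says that every product of an entry of T^-1 with an entry of T is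
    integral, and the entries of T n T^-1 are integral combinations of these same products. *)
Lemma conj_incl_sym (T n : 'M[F]_2) : (forall m, mxV m -> mxV (T^-1 * m * T)) ->
  mxV n -> mxV (T * n * T^-1).
Proof.
move=> h hn i j; rewrite !mxE; apply: (vr_sum hV) => a _.
rewrite !mxE mulr_suml; apply: (vr_sum hV) => b _.
have := h _ (mxV_delta j i) a b.
rewrite mxE (bigD1 i) //= big1 ?addr0 => [|k ki]; last first.
  by rewrite mxE big1 ?mul0r // => l _; rewrite mxE (negPf ki) andbF mulr0.
rewrite mxE (bigD1 j) //= big1 ?addr0 => [|k kj]; last by rewrite mxE (negPf kj) mulr0.
rewrite mxE !eqxx mulr1 => e.
have -> : T i b * n b a * T^-1 a j = n b a * (T^-1 a j * T i b) by ring.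
exact: (vrM hV).
Qed.

(** A larger order lies in some other conjugate of the matrix ring by [order_in_conj], and an
    inclusion between two conjugates is an equality by [conj_incl_sym]. *)
Lemma conjM_maximal P : P \is a GRing.unit -> maximal_order V (conjM P).
Proof.
move=> uP; split; first exact: conjM_order.
move=> Y hY PY y Yy.
have [Q uQ hQ] := order_in_conj hY.
have uT : P^-1 * Q \is a GRing.unit by rewrite mx_unitM unitrV uP.
have TV : (P^-1 * Q)^-1 = Q^-1 * P by rewrite invrM ?unitrV // invrK.
have h m : mxV m -> mxV ((P^-1 * Q)^-1 * m * (P^-1 * Q)).
  move=> hm; have /PY/hQ : conjM P (P * m * P^-1).
    by rewrite /conjM !mulrA mulVr // mul1r -mulrA mulVr // mulr1.
  by rewrite /conjM TV !mulrA.
have := conj_incl_sym h (hQ _ Yy); rewrite TV /conjM !mulrA.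
by rewrite -(mulrA _ Q Q^-1) mulrV // mulr1 -(mulrA _ Q Q^-1) mulrV // mulr1.
Qed.

Lemma maximal_orderP D : maximal_order V D ->
  exists2 P, P \is a GRing.unit & forall x, D x <-> conjM P x.
Proof.
case=> hD maxD; have [P uP hP] := order_in_conj hD.
exists P => // x; split; first exact: hP.
exact: (maxD _ (conjM_order uP) hP).
Qed.

Definition GLV (k : 'M[F]_2) := [/\ k \is a GRing.unit, mxV k & mxV k^-1].

(** Pivot on an entry that divides all the others: the swap [w] brings it to the corner, then its
    row and column are cleared. *)
Lemma smith (P : 'M[F]_2) : P \is a GRing.unit -> exists k1 k2 d1 d2,
  [/\ GLV k1, GLV k2, d1 != 0, d2 != 0 & P = k1 * mx2 d1 0 0 d2 * k2].
Proof.
have v1 := vr1 hV; have v0 := vr0 hV.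
have GLM k k' : GLV k -> GLV k' -> GLV (k * k').
  move=> [u1 m1 n1] [u2 m2 n2]; split; rewrite ?mx_unitM ?u1 ?u2 ?invrM //; exact: mxVM.
move=> uP.
have base (Q : 'M[F]_2) : Q \is a GRing.unit -> Q 0 0 != 0 ->
    (forall i j, V (Q i j / Q 0 0)) -> exists k1 k2 d1 d2,
    [/\ GLV k1, GLV k2, d1 != 0, d2 != 0 & Q = k1 * mx2 d1 0 0 d2 * k2].
  move=> uQ q0 hq; set q := Q 0 0 in q0 hq.
  pose b := Q 0 1 / q; pose c := Q 1 0 / q; pose d := Q 1 1 - q * b * c.
  have hb : V b by apply: hq.
  have hc : V c by apply: hq.
  have QE : Q = mx2 1 0 c 1 * mx2 q 0 0 d * mx2 1 b 0 1.
    by rewrite {1}(mx2E Q) !mx2M -/q /d /b /c; congr mx2; field.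
  have d0 : d != 0.
    move: uQ; rewrite QE !mx_unitM => /andP[/andP[_ +] _]; rewrite mx2_unit mulr0 subr0 mulf_eq0.
    by rewrite negb_or => /andP[].
  exists (mx2 1 0 c 1), (mx2 1 b 0 1), q, d; split=> //; split.
  - by rewrite mx2_unit mul0r subr0 mulr1 oner_neq0.
  - exact/mxV_mx2.
  - rewrite (@mx_inv_eq _ _ (mx2 1 0 (- c) 1)); last first.
      by rewrite mx2M mx2_1; congr mx2; ring.
    by apply/mxV_mx2; split=> //; apply: (vrN hV).
  - by rewrite mx2_unit mulr0 subr0 mulr1 oner_neq0.
  - exact/mxV_mx2.
  - rewrite (@mx_inv_eq _ _ (mx2 1 (- b) 0 1)); last first.
      by rewrite mx2M mx2_1; congr mx2; ring.
    by apply/mxV_mx2; split=> //; apply: (vrN hV).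
pose w := mx2 (0 : F) 1 1 0.
have ww : w * w = 1 by rewrite mx2M mx2_1; congr mx2; ring.
have GLw : GLV w.
  rewrite /GLV (mx_inv_eq ww) mx2_unit mul0r sub0r mulr1 oppr_eq0 oner_neq0.
  by split=> //; apply/mxV_mx2.
have GL1 : GLV 1 by split; rewrite ?unitr1 ?invr1 //; apply: mxV1.
have [] := @vr_seq_divisor _ _ hV [:: P 0 0; P 0 1; P 1 0; P 1 1].
  apply: NNPP => no; move: uP; rewrite (mx2E P) mx2_unit => /negP; apply.
  have z x : x \in [:: P 0 0; P 0 1; P 1 0; P 1 1] -> x = 0.
    by move=> xs; apply/eqP; apply/negPn/negP => x0; apply: no; exists x.
  have -> : P 0 0 = 0 by apply: z; rewrite !inE eqxx.
  have -> : P 0 1 = 0 by apply: z; rewrite !inE eqxx orbT.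
  by rewrite !mul0r subrr.
move=> x [xs x0 hx].
have h00 : V (P 0 0 / x) by apply: hx; rewrite !inE eqxx ?orbT.
have h01 : V (P 0 1 / x) by apply: hx; rewrite !inE eqxx ?orbT.
have h10 : V (P 1 0 / x) by apply: hx; rewrite !inE eqxx ?orbT.
have h11 : V (P 1 1 / x) by apply: hx; rewrite !inE eqxx ?orbT.
have red (k k' : 'M[F]_2) : GLV k -> GLV k' -> k * k = 1 -> k' * k' = 1 ->
    (k * P * k') 0 0 = x -> (forall i j, V ((k * P * k') i j / x)) ->
    exists k1 k2 d1 d2, [/\ GLV k1, GLV k2, d1 != 0, d2 != 0 & P = k1 * mx2 d1 0 0 d2 * k2].
  move=> hk hk' kk kk' e00 he.
  have uQ : k * P * k' \is a GRing.unit.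
    by rewrite !mx_unitM; case: hk => -> _ _; case: hk' => -> _ _; rewrite uP.
  have [||k1 [k2 [d1 [d2 [g1 g2 n1 n2 e]]]]] := base _ uQ; rewrite ?e00 //.
  exists (k * k1), (k2 * k'), d1, d2; split=> //; try exact: GLM.
  transitivity (k * (k * P * k') * k'); last by rewrite e !mulrA.
  by rewrite !mulrA kk mul1r -mulrA kk' mulr1.
have o1 : (1 : 'M[F]_2) * 1 = 1 by rewrite mulr1.
have Pw : P * w = mx2 (P 0 1) (P 0 0) (P 1 1) (P 1 0).
  by rewrite {1}(mx2E P) mx2M; congr mx2; ring.
have wP : w * P = mx2 (P 1 0) (P 1 1) (P 0 0) (P 0 1).
  by rewrite {1}(mx2E P) mx2M; congr mx2; ring.
have wPw : w * P * w = mx2 (P 1 1) (P 1 0) (P 0 1) (P 0 0).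
  by rewrite wP mx2M; congr mx2; ring.
have fin a b c d : V (a / x) -> V (b / x) -> V (c / x) -> V (d / x) ->
    forall i j, V (mx2 a b c d i j / x).
  by move=> ? ? ? ? i j; case: (ord2P i) => ->; case: (ord2P j) => ->; rewrite mx2_entries.
move: xs; rewrite !inE => /or4P[] /eqP xE.
- by apply: (red 1 1) => //; rewrite mul1r mulr1 // (mx2E P); apply: fin.
- by apply: (red 1 w) => //; rewrite mul1r Pw ?mx2_entries //; apply: fin.
- by apply: (red w 1) => //; rewrite mulr1 wP ?mx2_entries //; apply: fin.
- by apply: (red w w) => //; rewrite wPw ?mx2_entries //; apply: fin.
Qed.

(** The Smith form reduces to P = diag(d1, d2), where conjugation only rescales the off-diagonal
    entries, by d2/d1 and d1/d2. An off-diagonal entry of m m' is a combination of off-diagonal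
    entries of m and m' with diagonal, hence integral, coefficients; so a single factor c suffices
    for the product. *)
Lemma conjM_scaled_mul P c m m' : P \is a GRing.unit -> V c -> mxV m -> mxV m' ->
  conjM P (c *: m) -> conjM P (c *: m') -> conjM P (c *: (m * m')).
Proof.
move=> /smith[k1 [k2 [d1 [d2 [[u1 m1 n1] [u2 m2 n2] d10 d20 ->]]]]] hc hm hm'.
set d := mx2 d1 0 0 d2.
have ud : d \is a GRing.unit by rewrite mx2_unit mul0r subr0 mulf_neq0.
have dV : d^-1 = mx2 d1^-1 0 0 d2^-1.
  by apply: mx_inv_eq; rewrite mx2M mx2_1; congr mx2; field; rewrite ?d10 ?d20 //.
pose cj x := k1^-1 * x * k1.
have E x : conjM (k1 * d * k2) x <-> mxV (d^-1 * cj x * d).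
  rewrite /conjM !invrM ?mx_unitM ?u1 ?ud //; split=> h.
    have := mxVM (mxVM m2 h) n2.
    by rewrite !mulrA mulrV // mul1r -!mulrA mulrV // mulr1 /cj !mulrA.
  by have := mxVM (mxVM n2 h) m2; rewrite /cj !mulrA.
have cjZ x : cj (c *: x) = c *: cj x by rewrite /cj -scalerAr -scalerAl.
have cjM x y : cj (x * y) = cj x * cj y by rewrite /cj !mulrA mulrK.
have hcj x : mxV x -> mxV (cj x) by move=> hx; apply: mxVM => //; apply: mxVM.
rewrite !E !cjZ cjM.
move/hcj: hm; move/hcj: hm'; move: (cj m) (cj m') => n n'.
rewrite (mx2E n) (mx2E n') dV; move: (n 0 0) (n 0 1) (n 1 0) (n 1 1) => x y z w.
move: (n' 0 0) (n' 0 1) (n' 1 0) (n' 1 1) => x' y' z' w'.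
rewrite !mx2_simp !mxV_mx2 => [[Vx' Vy' Vz' Vw'] [Vx Vy Vz Vw]].
move=> [a1 a2 a3 a4] [b1 b2 b3 b4].
have S e f : V e -> V f -> V (e + f) by apply: (vrD hV).
have M e f : V e -> V f -> V (e * f) by apply: (vrM hV).
have tr e f : V e -> e = f -> V f by move=> ? <-.
split.
- apply: (tr _ _ (M _ _ hc (S _ _ (M _ _ Vx Vx') (M _ _ Vy Vz')))); field; rewrite ?d10 ?d20 //.
- apply: (tr _ _ (S _ _ (M _ _ Vx b2) (M _ _ a2 Vw'))); field; rewrite ?d10 ?d20 //.
- apply: (tr _ _ (S _ _ (M _ _ a3 Vx') (M _ _ Vw b3))); field; rewrite ?d10 ?d20 //.
- apply: (tr _ _ (M _ _ hc (S _ _ (M _ _ Vz Vy') (M _ _ Vw Vw')))); field; rewrite ?d10 ?d20 //.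
Qed.

End Orders.

Lemma exists_argmin (T : Type) (P : T -> Prop) (f : T -> nat) :
  (exists x, P x) -> exists2 x, P x & forall y, P y -> (f x <= f y)%N.
Proof.
case=> x0 Px0; have [n] := ubnP (f x0); elim: n => // n IH in x0 Px0 *.
move=> fn; case: (classic (exists2 y, P y & (f y < f x0)%N)) => [[y Py fy]|no].
  by apply: (IH y) => //; apply: leq_trans fy _.
exists x0 => // y Py; rewrite leqNgt; apply/negP => fy; apply: no; by exists y.
Qed.

(** * Orders avoiding all O + pi P M P^-1 *)

Section Local.
Variables (K : fieldType) (v : K -> int).
Hypothesis hv : is_discrete_valuation v.

Local Notation O := (valring v).
Let hO : valuation_ring O := valring_valuation hv.

Lemma vge_valring x : vge v x 1 -> O x.
Proof. exact: vge_le. Qed.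

Lemma vgeMl x y N : O x -> vge v y N -> vge v (x * y) N.
Proof. by move=> hx hy; rewrite -[N]add0r; apply: vgeM. Qed.

Lemma vgeMr x y N : vge v x N -> O y -> vge v (x * y) N.
Proof. by rewrite mulrC => hx hy; apply: vgeMl. Qed.

Lemma vge_eq x y N : vge v x N -> x = y -> vge v y N.
Proof. by move=> h <-. Qed.

Lemma vge_div t x : t != 0 -> vge v x (v t) <-> O (x / t).
Proof.
move=> t0; have [->|x0] := eqVneq x 0; first by rewrite mul0r; split=> _; apply: vge0.
rewrite /valring !vgeE ?mulf_neq0 ?invr_eq0 // (val_mul hv) ?invr_eq0 // (val_inv hv) //.
by rewrite subr_ge0.
Qed.

Lemma vge_prime x y : O x -> O y -> vge v (x * y) 1 -> vge v x 1 \/ vge v y 1.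
Proof.
have [->|x0] := eqVneq x 0; first by left; apply: vge0.
have [->|y0] := eqVneq y 0; first by right; apply: vge0.
rewrite /valring !vgeE ?mulf_neq0 // (val_mul hv) //; move: (v x) (v y) => a b; lia.
Qed.

Lemma vge_sqr x : O x -> vge v (x * x) 1 -> vge v x 1.
Proof. by move=> hx /(vge_prime hx hx)[]. Qed.

Lemma unitP x : O x -> ~ vge v x 1 -> x != 0 /\ O x^-1.
Proof.
have [->|x0] := eqVneq x 0; first by move=> _ []; apply: vge0.
rewrite /valring !vgeE ?invr_eq0 // (val_inv hv) //; move: (v x) => a; lia.
Qed.

Lemma vge_cancel x y N : O x -> ~ vge v x 1 -> vge v (x * y) N -> vge v y N.
Proof.
move=> hx /(unitP hx)[x0 hx'] h; apply: vge_eq (vgeMl hx' h) _.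
by rewrite mulKf.
Qed.

(* T ^ 2 - l T - m is separable modulo the maximal ideal, or Eisenstein *)
Definition good (l m : K) : Prop :=
  (forall c, O c -> vge v (l - c - c) 1 -> vge v (m + c * c) 1 -> False) \/
  [/\ vge v l 1, vge v m 1 & ~ vge v m 2].

(** If s is not integral, p = t/s satisfies l + 2p = 0 modulo pi and p^2 + l p - m = 0 modulo pi^2.
    So -p is a double root of T^2 - l T - m modulo pi; in the Eisenstein case pi divides p, which
    forces pi^2 to divide m. *)
Lemma good_maximal l m s t : O l -> O m -> good l m ->
  O (s * l + t + t) -> O (t * t + l * s * t - m * s * s) -> O s /\ O t.
Proof.
move=> hl hm hg htr hn; have hs : O s; last first.
  split=> //; case: (vr_total hO t) => // ht.
  have [->|t0] := eqVneq t 0; first exact: (vr0 hO).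
  have -> : t = (t * t + l * s * t - m * s * s) * t^-1 - l * s + m * s * s * t^-1.
    by field.
  by vr_closed hO.
apply: NNPP => ns.
have s0 : s != 0 by apply/eqP => e; apply: ns; rewrite e; apply: vge0.
have hs : vge v s^-1 1.
  move: ns; rewrite /valring !vgeE ?invr_eq0 // (val_inv hv) //; move: (v s) => a; lia.
have hs' := vge_valring hs.
pose p := t / s.
have h1 : vge v (l + p + p) 1.
  by apply: vge_eq (vgeMl htr hs) _; rewrite /p; field.
have h2 : vge v (p * p + l * p - m) 2.
  apply: vge_eq (vgeMl hn (vgeM hv hs hs)) _; rewrite /p; field; exact: s0.
have h21 : O (p * p + l * p - m) by apply: vge_le h2.
have hp : O p.
  case: (vr_total hO p) => // hp.
  have [->|p0] := eqVneq p 0; first exact: (vr0 hO).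
  have -> : p = (p * p + l * p - m) * p^-1 - l + m * p^-1 by field.
  by vr_closed hO.
clearbody p.
case: hg => [nsq|[hl1 hm1 hm2]].
  apply: (nsq (- p)); first by vr_closed hO.
    by apply: vge_eq h1 _; ring.
  have h2' : vge v (p * p + l * p - m) 1 by apply: vge_le h2.
  by apply: vge_eq (vgeB hv (vgeMr h1 hp) h2') _; ring.
apply: hm2.
have pp : vge v p 1.
  apply: vge_sqr => //.
  have h2' : vge v (p * p + l * p - m) 1 by apply: vge_le h2.
  by apply: vge_eq (vgeD hv (vgeB hv h2' (vgeMr hl1 hp)) hm1) _; ring.
apply: vge_eq (vgeB hv (vgeD hv (vgeM hv pp pp) (vgeM hv hl1 pp)) h2) _; ring.
Qed.

Lemma good_nonscalar x y z w : mxV O (mx2 x y z w) -> good (x + w) (y * z - x * w) ->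
  vge v y 1 -> vge v z 1 -> vge v (x - w) 1 -> False.
Proof.
move=> /mxV_mx2[hx hy hz hw] hg y1 z1 xw1; case: hg => [nsq|[l1 m1 m2]].
  apply: (nsq x) => //; first by apply: vge_eq (vgeN hv xw1) _; ring.
  by apply: vge_eq (vgeD hv (vgeMl hy z1) (vgeMl hx xw1)) _; ring.
have xw : vge v (x * w) 1.
  by apply: vge_eq (vgeB hv (vgeMl hy z1) m1) _; ring.
have [x1 w1] : vge v x 1 /\ vge v w 1.
  case: (vge_prime hx hw xw) => h; split=> //.
    by apply: vge_eq (vgeB hv h xw1) _; ring.
  by apply: vge_eq (vgeD hv h xw1) _; ring.
exact: m2 (vgeB hv (vgeM hv y1 z1) (vgeM hv x1 w1)).
Qed.

Lemma GLV_unit_det a b c d : O a -> O b -> O c -> O d -> ~ vge v (a * d - b * c) 1 ->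
  GLV O (mx2 a b c d).
Proof.
move=> ha hb hc hd nD; have hD : O (a * d - b * c) by vr_closed hO.
have [D0 hD'] := unitP hD nD; split; first by rewrite mx2_unit.
  exact/mxV_mx2.
rewrite (@mx_inv_eq _ _ ((a * d - b * c)^-1 *: mx2 d (- b) (- c) a)).
  by apply: mxVZ => //; apply/mxV_mx2; split=> //; vr_closed hO.
by rewrite mx2Z mx2M mx2_1; congr mx2; field.
Qed.

(** The new basis is u, g u - (tr g) u with u = (e, f). Its determinant z e^2 - (x - w) e f - y f^2
    is a unit at one of (1, 0), (0, 1), (1, 1) unless its three coefficients all vanish modulo the
    maximal ideal. *)
Lemma companion_form g : mxV O g ->
  ~ [/\ vge v (g 0 1) 1, vge v (g 1 0) 1 & vge v (g 0 0 - g 1 1) 1] ->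
  exists2 U, GLV O U & U^-1 * g * U = mx2 (\tr g) (- \det g) 1 0.
Proof.
rewrite (mx2E g) !mx2_entries mx2_tr mx2_det.
move: (g 0 0) (g 0 1) (g 1 0) (g 1 1) => x y z w /mxV_mx2[hx hy hz hw] ns.
pose U e f := mx2 e (y * f - w * e) f (z * e - x * f).
have C e f : GLV O (U e f) -> (U e f)^-1 * mx2 x y z w * U e f =
    mx2 (x + w) (- (x * w - y * z)) 1 0.
  move=> [u _ _]; rewrite -mulrA.
  have -> : mx2 x y z w * U e f = U e f * mx2 (x + w) (- (x * w - y * z)) 1 0.
    by rewrite /U !mx2M; congr mx2; ring.
  by rewrite mulrA mulVr // mul1r.
suff [e [f hU]] : exists e f, GLV O (U e f) by exists (U e f) => //; apply: C.
have v1 := vr1 hO; have v0 := vr0 hO.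
case: (classic (vge v z 1)) => z1; last first.
  exists 1, 0; apply: GLV_unit_det; try by vr_closed hO.
  by move=> h; apply: z1; apply: vge_eq h _; ring.
case: (classic (vge v y 1)) => y1; last first.
  exists 0, 1; apply: GLV_unit_det; try by vr_closed hO.
  by move=> h; apply: y1; apply: vge_eq (vgeN hv h) _; ring.
exists 1, 1; apply: GLV_unit_det; try by vr_closed hO.
move=> h; apply: ns; split=> //.
by apply: vge_eq (vgeB hv (vgeB hv z1 y1) h) _; ring.
Qed.

Variable pi : K.
Hypotheses (pi0 : pi != 0) (vpi : v pi = 1).

Lemma vge_pi x : vge v x 1 <-> O (x / pi).
Proof. by rewrite -vge_div // vpi. Qed.

Lemma O_pi : O pi.
Proof. by right; rewrite vpi. Qed.

(* scal_mod t P is the order O + t P M_2(O) P^-1 *)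
Definition scal_mod (t : K) (P x : 'M[K]_2) : Prop :=
  exists c m, [/\ O c, conjM O P m & x = c%:M + t *: m].

Lemma scal_modP t P x : t != 0 -> O t -> P \is a GRing.unit ->
  let y := P^-1 * x * P in
  scal_mod t P x <-> [/\ O (y 0 0), O (y 0 1 / t), O (y 1 0 / t) & O ((y 0 0 - y 1 1) / t)].
Proof.
move=> t0 ht uP y; split=> [[c [m [hc hm xE]]]|[h1 h2 h3 h4]].
  have -> : y = c%:M + t *: (P^-1 * m * P).
    rewrite /y xE mulrDr mulrDl -scalerAr -scalerAl; congr (_ + _).
    by rewrite -scalemx1 -scalerAr mulr1 -scalerAl mulVr.
  move: hm; rewrite /conjM; move: (P^-1 * m * P) => n.
  rewrite (mx2E n); move: (n 0 0) (n 0 1) (n 1 0) (n 1 1) => a b d e /mxV_mx2[ha hb hd he].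
  rewrite !mx2_simp !mx2_entries !add0r ![t * _]mulrC !mulfK //; split=> //.
    by vr_closed hO.
  have -> : (c + a * t - (c + e * t)) / t = a - e by field.
  by vr_closed hO.
exists (y 1 1), (P * mx2 ((y 0 0 - y 1 1) / t) (y 0 1 / t) (y 1 0 / t) 0 * P^-1).
split.
- have -> : y 1 1 = y 0 0 - (y 0 0 - y 1 1) / t * t by field.
  by vr_closed hO.
- rewrite /conjM !mulrA mulVr // mul1r -mulrA mulVr // mulr1.
  by apply/mxV_mx2; split=> //; apply: vge0.
- have -> : x = P * y * P^-1 by rewrite /y !mulrA mulrV // mul1r -mulrA mulrV // mulr1.
  rewrite scalerAl scalerAr.
  have -> : (y 1 1)%:M = P * (y 1 1)%:M * P^-1.
    by rewrite -scalemx1 -scalerAr mulr1 -scalerAl mulrV.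
  rewrite -mulrDl -mulrDr; congr (_ * _ * _).
  by rewrite {1}(mx2E y) !mx2_simp; congr mx2; field.
Qed.

Definition not_scal_mod (R : 'M[K]_2 -> Prop) : Prop :=
  forall P, P \is a GRing.unit -> ~ (forall x, R x -> scal_mod pi P x).

Definition subalg (R : 'M[K]_2 -> Prop) : Prop :=
  [/\ R 1, forall x y, R x -> R y -> R (x + y), forall x y, R x -> R y -> R (x * y)
    & forall k x, O k -> R x -> R (k *: x)].

Lemma order_subalg R : is_order O R -> subalg R.
Proof. by move=> hR; case: (hR) => *; split=> //; apply: order_scale. Qed.

Definition conjR (P : 'M[K]_2) (R : 'M[K]_2 -> Prop) (x : 'M[K]_2) : Prop :=
  R (P * x * P^-1).

Lemma conjR_subalg P R : P \is a GRing.unit -> subalg R -> subalg (conjR P R).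
Proof.
move=> uP [h1 hD hM hZ]; split; rewrite /conjR.
- by rewrite mulr1 mulrV.
- by move=> x y hx hy; rewrite mulrDr mulrDl; apply: hD.
- by move=> x y hx hy; have := hM _ _ hx hy; rewrite !mulrA mulrVK.
- by move=> k x hk hx; rewrite -scalerAr -scalerAl; apply: hZ.
Qed.

Lemma conjR_not_scal P R : P \is a GRing.unit -> not_scal_mod R ->
  not_scal_mod (conjR P R).
Proof.
move=> uP nR Q uQ h; apply: (nR (P * Q)); first by rewrite mx_unitM uP.
move=> x Rx; have /h[c [m [hc hm e]]] : conjR P R (P^-1 * x * P).
  by rewrite /conjR !mulrA mulrV // mul1r mulrK.
exists c, (P * m * P^-1); split=> //.
  by move: hm; rewrite /conjM invrM // !mulrA mulrVK // mulrVK.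
have -> : x = P * (P^-1 * x * P) * P^-1 by rewrite !mulrA mulrV // mul1r mulrK.
rewrite e mulrDr mulrDl -scalerAr -scalerAl; congr (_ + _).
by rewrite -scalemx1 -scalerAr mulr1 -scalerAl mulrV.
Qed.

(* If C has a repeated eigenvalue at this vertex, either some element moves its
   eigenline, or [not_scal_mod] applied to the vertex behind that eigenline yields an
   element of valuation 1 in the upper right corner. *)
Lemma find_good_companion R l m : subalg R -> not_scal_mod R ->
  (forall x, R x -> mxV O x) -> R (mx2 l m 1 0) -> vge v l 1 -> vge v m 1 ->
  exists2 g, R g & good (\tr g) (- \det g).
Proof.
move=> [R1 RD RM RZ] nR RV RC l1 m1.
have hl := vge_valring l1; have hm := vge_valring m1.
have v1 := vr1 hO; have v0 := vr0 hO.
case: (classic (vge v m 2)) => m2; last first.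
  exists (mx2 l m 1 0) => //; rewrite mx2_tr mx2_det mulr0 mulr1 sub0r opprK addr0.
  by right.
case: (classic (exists2 h, R h & ~ vge v (h 0 1) 1)) => [[h Rh]|no].
  (* Modulo pi this product has trace y, the upper right entry of h, and determinant 0; T^2 - y T is
     separable. *)
  move=> y1; exists (h * mx2 l m 1 0); first exact: RM.
  have := RV _ Rh; move: Rh y1; rewrite (mx2E h) mx2_entries.
  move: (h 0 0) (h 0 1) (h 1 0) (h 1 1) => x y z w Rh y1 /mxV_mx2[hx hy hz hw].
  rewrite mx2M mx2_tr mx2_det; left=> c hc t1 n1; apply: y1.
  have c1 : vge v c 1.
    apply: vge_sqr => //; have hd : O (x * w - y * z) by vr_closed hO.
    by apply: vge_eq (vgeB hv n1 (vgeMl hd m1)) _; ring.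
  have e := vgeB hv (vgeB hv t1 (vgeMl hx l1)) (vgeMl hz m1).
  by apply: vge_eq (vgeD hv (vgeD hv e c1) c1) _; ring.
have y1 h : R h -> vge v (h 0 1) 1.
  by move=> Rh; apply: NNPP => n; apply: no; exists h.
have uP : mx2 pi 0 0 1 \is a GRing.unit by rewrite mx2_unit mulr1 mulr0 subr0.
have [h Rh nh] : exists2 h, R h & ~ scal_mod pi (mx2 pi 0 0 1) h.
  apply: NNPP => no'; apply: (nR _ uP) => h Rh; apply: NNPP => nh; apply: no'.
  by exists h.
move: nh; rewrite scal_modP //; last exact: O_pi.
rewrite (@mx_inv_eq _ _ (mx2 pi^-1 0 0 1)); last first.
  by rewrite mx2M mx2_1; congr mx2; field.
have := RV _ Rh; have := y1 _ Rh; move: Rh; rewrite (mx2E h) !mx2M !mx2_entries.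
move: (h 0 0) (h 0 1) (h 1 0) (h 1 1) => x y z w Rh hy1 /mxV_mx2[hx hy hz hw] nh.
(* Modulo pi the element is triangular with eigenvalues x and w, so it is good when they differ. The
   identity used is that (x - w)^2 + 4 y z is the discriminant. *)
case: (classic (vge v (x - w) 1)) => xw1; last first.
  exists (mx2 x y z w) => //; rewrite mx2_tr mx2_det; left=> c hc t1 n1; apply: xw1.
  have h1 : O (x + w + c + c) by vr_closed hO.
  have h4 : O 4%:R by rewrite -natr1 (natrD _ 2 1) (natrD _ 1 1); vr_closed hO.
  apply: vge_sqr; first by vr_closed hO.
  apply: vge_eq (vgeD hv (vgeD hv (vgeMl h1 t1) (vgeMl h4 n1))
    (vgeMl h4 (vgeN hv (vgeMr hy1 hz)))) _.
  ring.
have y2 : ~ vge v y 2.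
  move=> y2; apply: nh.
  have E1 : (pi^-1 * x + 0 * z) * pi + (pi^-1 * y + 0 * w) * 0 = x by field.
  have E2 : (pi^-1 * x + 0 * z) * 0 + (pi^-1 * y + 0 * w) * 1 = y / pi by field.
  have E3 : (0 * x + 1 * z) * pi + (0 * y + 1 * w) * 0 = z * pi by ring.
  have E4 : (0 * x + 1 * z) * 0 + (0 * y + 1 * w) * 1 = w by ring.
  rewrite E1 E2 E3 E4 mulfK //; split=> //; last exact/vge_pi.
  have -> : y / pi / pi = y / (pi * pi) by field.
  apply/vge_div; first by rewrite mulf_neq0.
  by rewrite (val_mul hv) // vpi.
have Rx c x' : O c -> R x' -> R (x' - c%:M).
  move=> hc h'; apply: RD => //; rewrite -scalemx1 -scaleNr; apply: RZ => //; vr_closed hO.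
(* Now pi divides y exactly once. Subtracting x leaves the determinant -y z, which is Eisenstein
   when z is a unit; otherwise adding the companion matrix turns z into the unit z + 1, and the
   terms with l and m only change the determinant modulo pi^2. *)
case: (classic (vge v z 1)) => z1.
  exists (mx2 x y z w - x%:M + mx2 l m 1 0); first by apply: RD => //; apply: Rx.
  rewrite !mx2_simp mx2_tr mx2_det; right.
  have w1 := vgeN hv xw1.
  have hz1 : O (z + 1) by vr_closed hO.
  have hwx : O (w - x) by vr_closed hO.
  split.
  - by apply: vge_eq (vgeD hv l1 w1) _; ring.
  - have e := vgeMr (vgeD hv hy1 m1) hz1.
    by apply: vge_eq (vgeB hv e (vgeMr l1 hwx)) _; ring.
  - move=> D; apply: y2.
    have e1 : vge v (l * (w - x)) 2.
      by apply: vge_eq (vgeM hv l1 w1) _; ring.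
    have e2 : vge v (y * z) 2 := vgeM hv hy1 z1.
    by apply: vge_eq (vgeB hv (vgeB hv (vgeD hv D e1) (vgeMr m2 hz1)) e2) _; ring.
exists (mx2 x y z w - x%:M); first exact: Rx.
rewrite !mx2_simp mx2_tr mx2_det; right; split.
- by apply: vge_eq (vgeN hv xw1) _; ring.
- by apply: vge_eq (vgeMr hy1 hz) _; ring.
- by move=> D; apply: y2; apply: (vge_cancel hz z1); apply: vge_eq D _; ring.
Qed.

Lemma tr_conj (P x : 'M[K]_2) : P \is a GRing.unit -> \tr (P * x * P^-1) = \tr x.
Proof. by move=> uP; rewrite -mulmxE mxtrace_mulC mulmxE mulrA mulVr // mul1r. Qed.

Lemma det_conj (P x : 'M[K]_2) : P \is a GRing.unit -> \det (P * x * P^-1) = \det x.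
Proof.
move=> uP; rewrite -!mulmxE !det_mulmx mulrAC -det_mulmx mulmxE mulrV //.
by rewrite det1 mul1r.
Qed.

Lemma conjM_GLV U x : GLV O U -> mxV O x -> mxV O (U^-1 * x * U).
Proof. by move=> [_ h1 h2] hx; apply: mxVM => //; apply: mxVM. Qed.

(** Take g not scalar modulo pi, in companion form. If its polynomial is not good, it is (T - c)^2
    modulo pi, and translation by c leads to [find_good_companion]. *)
Lemma find_good R : subalg R -> not_scal_mod R -> (forall x, R x -> mxV O x) ->
  exists P, [/\ P \is a GRing.unit, forall x, R x -> conjM O P x
    & exists2 g, R g & good (\tr g) (- \det g)].
Proof.
move=> sR nR RV.
have [g Rg ng] : exists2 g, R g & ~ scal_mod pi 1 g.
  apply: NNPP => no; apply: (nR 1); first exact: unitr1.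
  by move=> h Rh; apply: NNPP => nh; apply: no; exists h.
have [|U hU eU] := companion_form (RV _ Rg).
  case=> a b c; apply: ng; rewrite scal_modP ?unitr1 //; last exact: O_pi.
  rewrite invr1 mul1r mulr1; split; try exact/vge_pi.
  exact: RV.
have [uU _ _] := hU.
have hg := RV _ Rg.
have hl : O (\tr g).
  by rewrite (mx2E g) mx2_tr; apply: (vrD hO).
have hm : O (- \det g).
  by rewrite (mx2E g) mx2_det; move: (hg 0 0) (hg 0 1) (hg 1 0) (hg 1 1) => *; vr_closed hO.
case: (classic (good (\tr g) (- \det g))) => [gg|ngg].
  by exists 1; split; rewrite ?unitr1 //; [move=> x /RV; rewrite /conjM invr1 mul1r mulr1|exists g].
have [c hc [l1 m1]] : exists2 c, O c & vge v (\tr g - c - c) 1 /\ vge v (- \det g + c * c) 1.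
  by apply: NNPP => no; apply: ngg; left=> c hc h1 h2; apply: no; exists c.
(* Conjugating the companion matrix minus c by [U'] gives the companion matrix of the polynomial
   translated by c. *)
pose U' := mx2 1 c 0 1.
have hU' : GLV O U'.
  apply: GLV_unit_det => //; try exact: vge0; try exact: (vr1 hO).
  rewrite mulr0 subr0 mulr1 vgeE ?oner_neq0 // (val_one hv); by [].
have [uU' _ _] := hU'.
have uW : U * U' \is a GRing.unit by rewrite mx_unitM uU.
set l := \tr g in eU hl l1; set m := - \det g in eU hm m1.
have WV : (U * U')^-1 = U'^-1 * U^-1 by rewrite invrM.
have RW x : conjR (U * U') R x -> mxV O x.
  move=> /RV h; have := conjM_GLV hU' (conjM_GLV hU h).
  by rewrite WV !mulrA !(mulrVK uU) mulVr // mul1r (mulrVK uU').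
have sW := conjR_subalg uW sR.
have [|||h Rh gh] := find_good_companion (l := l - c - c) (m := m + l * c - c * c)
    sW (conjR_not_scal uW nR) RW.
- rewrite /conjR WV.
  have -> : mx2 (l - c - c) (m + l * c - c * c) 1 0 = U'^-1 * (mx2 l m 1 0 - c%:M) * U'.
    rewrite (@mx_inv_eq _ U' (mx2 1 (- c) 0 1)); last first.
      by rewrite mx2M mx2_1; congr mx2; ring.
    by rewrite !mx2_simp; congr mx2; ring.
  rewrite -eU.
  have -> : U * U' * (U'^-1 * (U^-1 * g * U - c%:M) * U') * (U'^-1 * U^-1) = g - c%:M.
    rewrite !mulrA mulrK // mulrK // mulrBr mulrBl !mulrA mulrV // mul1r mulrK //.
    by rewrite -scalemx1 -scalerAr mulr1 -scalerAl mulrV.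
  case: sR => S1 SD _ SZ; apply: SD => //; rewrite -scalemx1 -scaleNr; apply: SZ => //; vr_closed hO.
- exact: l1.
- apply: vge_eq (vgeD hv m1 (vgeMl hc l1)) _; ring.
- exists (U * U'); split=> //.
    by move=> x Rx; apply: RW; rewrite /conjR mx_conjK.
  exists (U * U' * h * (U * U')^-1) => //.
  by rewrite tr_conj // det_conj.
Qed.

(* With C the companion matrix [mx2 l m 1 0], [quad l m s t] is s C + t, [norm2] is its
   determinant and [toprow s t] is e12 (s C + t); so [basic_form] says that P^-1 R P is
   O[C] + e12 (r C + s) O[C]. *)
Definition quad (l m s t : K) := mx2 (s * l + t) (s * m) s t.

Definition norm2 (l m s t : K) := t * t + l * s * t - m * s * s.

Definition toprow (s t : K) := mx2 s t 0 0.

Record basic_form (R : 'M[K]_2 -> Prop) (P : 'M[K]_2) (l m r s : K) : Prop := BasicForm {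
  bf_unit : P \is a GRing.unit;
  bf_l : O l;
  bf_m : O m;
  bf_good : good l m;
  bf_r : O r;
  bf_s : O s;
  bf_norm : norm2 l m r s != 0;
  bf_eq : forall x, conjR P R x <-> exists a b c d, [/\ O a, O b, O c, O d &
    x = quad l m a b + toprow r s * quad l m c d] }.

Lemma seq_common_denom n (k : 'I_n -> K) : exists c, [/\ c != 0, O c & forall i, O (c * k i)].
Proof.
have [|x [_ x0 hx]] := @vr_seq_divisor _ _ hO (1 :: [seq k i | i <- enum 'I_n]).
  by exists 1; rewrite ?inE ?eqxx // oner_neq0.
exists x^-1; split; first by rewrite invr_eq0.
  by rewrite -[x^-1]mul1r; apply: hx; rewrite inE eqxx.
by move=> i; rewrite mulrC; apply: hx; rewrite inE (map_f k) ?orbT // mem_enum.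
Qed.

Lemma full_scale R : full_order O R -> forall a, exists c, [/\ c != 0, O c & R (c *: a)].
Proof.
move=> [hR sp] a; have [n [r [k [hr ->]]]] := sp a.
have [c [c0 hc hk]] := seq_common_denom k.
have [R1 RD RM RZ] := order_subalg hR.
exists c; split=> //; rewrite scaler_sumr; apply: (big_ind R) => //.
  by rewrite -(scale0r 1); apply: RZ => //; apply: vge0.
by move=> i _; rewrite scalerA; apply: RZ.
Qed.

Lemma toprow_quadM l m r s c d : toprow r s * quad l m c d =
  toprow (r * (c * l + d) + s * c) (r * (c * m) + s * d).
Proof. by rewrite mx2M; congr mx2; ring. Qed.

(** Division of h C + k by r C + s in K[C]: multiply by the conjugate -r C + (s + r l) and divide by
    the norm. *)
Lemma toprow_div l m r s h k : norm2 l m r s != 0 -> toprow h k =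
  toprow r s * quad l m ((h * s - k * r) / norm2 l m r s)
    ((k * (s + r * l) - h * r * m) / norm2 l m r s).
Proof. by move=> n0; rewrite toprow_quadM; congr mx2; rewrite /norm2; field. Qed.

(** Once C is in R, every element of R differs from one of O[C] by a matrix e12 (h C + k) of R. The
    h C + k that occur form an ideal of O[C], which is principal because O[C] is integrally
    closed. *)
Lemma basic_form_exists R : full_order O R -> not_scal_mod R ->
  exists P l m r s, basic_form R P l m r s.
Proof.
move=> fR nR; have hR := fR.1.
have [Q uQ hQ] := order_in_conj hO hR.
have sQ := conjR_subalg uQ (order_subalg hR).
have nQ := conjR_not_scal uQ nR.
have VQ x : conjR Q R x -> mxV O x.
  by move=> /hQ; rewrite /conjM mx_conjVK.
have [P0 [uP0 hP0 [g Rg gg]]] := find_good sQ nQ VQ.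
have gV := hP0 _ Rg.
pose g' := P0^-1 * g * P0.
have uV : P0^-1 \is a GRing.unit by rewrite unitrV.
have tg : \tr g' = \tr g by rewrite /g' -{2}(invrK P0) tr_conj.
have dg : \det g' = \det g by rewrite /g' -{2}(invrK P0) det_conj.
have [|U hU eU] := companion_form gV.
  rewrite -/g'; case=> a b c; move: gV gg; rewrite /conjM -/g' -tg -dg.
  rewrite (mx2E g') mx2_tr mx2_det opprB => V1 V2.
  exact: (good_nonscalar V1 V2 a b c).
rewrite -/g' tg dg in eU.
have [uU _ _] := hU.
set l := \tr g in eU gg; set m := - \det g in eU gg.
pose P := Q * P0 * U.
have uP : P \is a GRing.unit by rewrite !mx_unitM uQ uP0.
have PV : P^-1 = U^-1 * P0^-1 * Q^-1 by rewrite /P !invrM ?mx_unitM ?uQ ?uP0 // mulrA.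
have RV x : conjR P R x -> mxV O x.
  rewrite /conjR PV => h; have {}h : conjR Q R (P0 * (U * x * U^-1) * P0^-1).
    by move: h; rewrite /conjR /P !mulrA.
  by have := conjM_GLV hU (hP0 _ h); rewrite !mx_conjVK.
have RC : conjR P R (mx2 l m 1 0).
  rewrite -eU /conjR PV /g' /P !mulrA mulrK // mulrK // mulrK // mulrK //.
have sP := conjR_subalg uP (order_subalg hR).
have [R1 RD RM RZ] := sP.
have v1 := vr1 hO; have v0 := vr0 hO.
have CV := RV _ RC.
have [hl hm _ _] : [/\ O l, O m, O 1 & O 0] by apply/mxV_mx2.
have quadE a b : quad l m a b = a *: mx2 l m 1 0 + b *: 1.
  by rewrite mx2_1 !mx2_simp; congr mx2; ring.
have Rquad a b : O a -> O b -> conjR P R (quad l m a b).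
  by move=> ha hb; rewrite quadE; apply: RD; apply: RZ.
pose L (p : K * K) := conjR P R (toprow p.1 p.2) /\ norm2 l m p.1 p.2 != 0.
have LO a b : conjR P R (toprow a b) -> O a /\ O b.
  by move=> /RV/mxV_mx2[].
have LN a b : conjR P R (toprow a b) -> O (norm2 l m a b).
  by move=> /LO[ha hb]; rewrite /norm2; vr_closed hO.
(* The generator rho is an element whose nonzero norm has least valuation; fullness provides a
   candidate, a multiple of e12. *)
have [|[r s] [Lrs n0] rsmin] := @exists_argmin _ L (fun p => `|v (norm2 l m p.1 p.2)|%N).
  have [c [c0 hc Rc]] := full_scale fR (P * toprow 0 1 * P^-1).
  exists (0, c); split=> /=; last first.
    rewrite /norm2 (_ : _ - _ = c * c); last by ring.
    by rewrite mulf_neq0.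
  move: Rc; rewrite /conjR scalerAl scalerAr mx2Z.
  by rewrite /toprow !mulr0 mulr1.
have [hr hs] := LO _ _ Lrs.
have Rmul x a b : conjR P R x -> O a -> O b -> conjR P R (x * quad l m a b).
  by move=> hx ha hb; apply: RM => //; apply: Rquad.
exists P, l, m, r, s; split=> // x; split=> [Rx|[a [b [c [d [ha hb hc hd ->]]]]]]; last first.
  by apply: RD; [apply: Rquad|apply: Rmul].
have := RV _ Rx; move: Rx; rewrite (mx2E x).
move: (x 0 0) (x 0 1) (x 1 0) (x 1 1) => a b c d Rx /mxV_mx2[ha hb hc hd].
pose h := a - c * l - d; pose k := b - c * m.
have Rh : conjR P R (toprow h k).
  have -> : toprow h k = mx2 a b c d + (-1) *: quad l m c d.
    by rewrite !mx2_simp /h /k; congr mx2; ring.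
  by apply: RD => //; apply: RZ; [vr_closed hO|apply: Rquad].
pose e := (h * s - k * r) / norm2 l m r s.
pose f := (k * (s + r * l) - h * r * m) / norm2 l m r s.
have hef : toprow h k = toprow r s * quad l m e f by apply: toprow_div.
have divN h' k' : conjR P R (toprow h' k') -> O (norm2 l m h' k' / norm2 l m r s).
  move=> R'; have [->|n'] := eqVneq (norm2 l m h' k') 0; first by rewrite mul0r.
  apply/(vge_div _ n0); rewrite vgeE //.
  have := LN _ _ R'; have := LN _ _ Lrs; rewrite /valring !vgeE //.
  have := rsmin (h', k'); rewrite /L /= => /(_ (conj R' n')).
  move: (v (norm2 l m r s)) (v (norm2 l m h' k')) => i j; lia.
(* Let q = e C + f be the quotient of h C + k by rho. By minimality N(q) is in O, and so is N(1 +
   q), since rho + h C + k is again in the ideal. Then the trace N(1 + q) - 1 - N(q) is in O and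
   [good_maximal] applies. *)
have [he hf] : O e /\ O f.
  have hne : norm2 l m e f = norm2 l m h k / norm2 l m r s.
    by rewrite /e /f; move: n0; rewrite /norm2 => n0; field.
  have hN : O (norm2 l m e f) by rewrite hne; apply: divN.
  apply: (good_maximal hl hm gg _ hN).
  have -> : e * l + f + f = norm2 l m (r + h) (s + k) / norm2 l m r s - 1 - norm2 l m e f.
    by rewrite /e /f; move: n0; rewrite /norm2 => n0; field.
  apply: (vrB hO) => //; apply: (vrB hO) => //; apply: divN.
  have -> : toprow (r + h) (s + k) = toprow r s + toprow h k.
    by rewrite mx2D !addr0.
  exact: RD.
exists c, d, e, f; split=> //; rewrite -hef !mx2D /h /k; congr mx2; ring.
Qed.

End Local.

(** * Gorenstein and Bass orders *)

Section Invertible.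
Variables (F : fieldType) (V : F -> Prop).
Hypothesis hV : valuation_ring V.

Lemma full_lattice_mul (X : 'M[F]_2 -> Prop) u : u \is a GRing.unit ->
  full_lattice V X -> full_lattice V (fun x => X (u^-1 * x)).
Proof.
move=> uu [[s hs] sp]; split.
  exists [seq u * x | x <- s] => x; rewrite hs !O_spanP // size_map.
  have e (c : nat -> F) : \sum_(i < size s) c i *: [seq u * x | x <- s]`_i =
      u * \sum_(i < size s) c i *: s`_i.
    by rewrite mulr_sumr; apply: eq_bigr => i _; rewrite (nth_map 0) // scalerAr.
  split=> -[c [hc h]]; exists c; split=> //.
    by rewrite e -h mulrA mulrV // mul1r.
  by rewrite h e mulrA mulVr // mul1r.
move=> a; have [n [r [k [hr e]]]] := sp (u^-1 * a).
exists n, (fun i => u * r i), k; split; first by move=> i; rewrite mulrA mulVr // mul1r.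
rewrite -[a]mul1r -(mulrV uu) -mulrA e mulr_sumr; apply: eq_bigr => i _.
by rewrite scalerAr.
Qed.

(** The codifferent is u R by one hypothesis and R u by the other. Hence u normalizes R, and u^-1 R
    is the inverse ideal. *)
Lemma Gorenstein_of_generator R u : u \is a GRing.unit -> full_order V R ->
  (forall x, codifferent V R x <-> R (u^-1 * x)) ->
  (forall x, codifferent V R x <-> R (x * u^-1)) -> Gorenstein V R.
Proof.
move=> uu fR hl hr; split=> //; have [[R1 RD RN RM fg] sp] := fR.
have R0 : R 0 by rewrite -(subrr 1); apply: RD => //; apply: RN.
have lat : full_lattice V R by [].
have uV : u^-1 \is a GRing.unit by rewrite unitrV.
have sw x : R (u * x) <-> R (x * u).
  have := iff_trans (iff_sym (hl (u * x * u))) (hr (u * x * u)).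
  by rewrite mulrK // !mulrA mulVr // mul1r => h; split=> /h.
have fl : full_lattice V (codifferent V R).
  have [[s hs] sp'] := full_lattice_mul uu lat; split.
    by exists s => x; rewrite hl.
  by move=> a; have [n [r [k [h e]]]] := sp' a; exists n, r, k; split=> // i; apply/hl.
split.
  split=> // r j Rr Jj; split; first by apply/hr; rewrite -mulrA; apply: RM => //; apply/hr.
  by apply/hl; rewrite mulrA; apply: RM => //; apply/hl.
exists (fun x => R (u * x)); split.
- split; first by have := full_lattice_mul uV lat; rewrite invrK.
  move=> r j Rr Jj; split; last by rewrite mulrA; apply: RM.
  by apply/sw; rewrite -mulrA; apply: RM => //; apply/sw.
- move=> x; split=> [[n [a [b [hab ->]]]]|Rx].
    apply: (big_ind R) => // i _; have [/hr Ja Jb] := hab i.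
    by have := RM _ _ Ja Jb; rewrite mulrA mulrVK.
  exists 1%N, (fun=> x * u), (fun=> u^-1); split; last by rewrite big_ord1 mulrK.
  by move=> i; rewrite mulrV //; split=> //; apply/hr; rewrite mulrK.
- move=> x; split=> [[n [a [b [hab ->]]]]|Rx].
    apply: (big_ind R) => // i _; have [/sw Ja /hl Jb] := hab i.
    by have := RM _ _ Ja Jb; rewrite mulrA mulrK.
  exists 1%N, (fun=> u^-1), (fun=> u * x); split; last by rewrite big_ord1 mulKr.
  by move=> i; rewrite mulrV //; split=> //; apply/hl; rewrite mulKr.
Qed.

(** The adjugate, that is, the standard involution; it exchanges left and right multiplication. *)
Definition adj2 (x : 'M[F]_2) := (\tr x)%:M - x.

Lemma adj2_mx2 a b c d : adj2 (mx2 a b c d) = mx2 d (- b) (- c) a.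
Proof. by rewrite /adj2 mx2_tr !mx2_simp; congr mx2; ring. Qed.

Lemma adj2K x : adj2 (adj2 x) = x.
Proof. by rewrite (mx2E x) !adj2_mx2 !opprK. Qed.

Lemma adj2M x y : adj2 (x * y) = adj2 y * adj2 x.
Proof.
rewrite (mx2E x) (mx2E y); move: (x 0 0) (x 0 1) (x 1 0) (x 1 1) => a b c d.
move: (y 0 0) (y 0 1) (y 1 0) (y 1 1) => a' b' c' d'.
by rewrite mx2M !adj2_mx2 mx2M; congr mx2; ring.
Qed.

Lemma codifferent_adj2 R x : R 1 -> (forall r, R r -> V (\tr r)) ->
  codifferent V R x -> codifferent V R (adj2 x).
Proof.
move=> R1 hR hx r Rr; rewrite /adj2 mulrBl raddfB /=.
rewrite -scalemx1 -scalerAl mul1r mxtraceZ; apply: (vrB hV); last exact: hx.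
by apply: (vrM hV); [rewrite -[x]mulr1; apply: hx|apply: hR].
Qed.

End Invertible.

(** * The codifferent of an order in basic form, and the criterion for Bass orders *)

Section Bass.
Variables (K : fieldType) (v : K -> int).
Hypothesis hv : is_discrete_valuation v.
Variable pi : K.
Hypotheses (pi0 : pi != 0) (vpi : v pi = 1).

Local Notation O := (valring v).
Let hO : valuation_ring O := valring_valuation hv.

Section Basic.
Variables (R : 'M[K]_2 -> Prop) (P : 'M[K]_2) (l m r s : K).
Hypotheses (fR : full_order O R) (bf : basic_form v R P l m r s).

Let n := norm2 l m r s.
(** Chosen so that x -> tr(w^-1 x) reads off the coordinate c in [tr1]; its inverse will generate
    the codifferent. *)
Let w := mx2 s (r * m - s * l) (- r) (- s).
Let R0 := conjR P R.

Let n0 : n != 0. Proof. exact: bf_norm bf. Qed.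
Let hl := bf_l bf.
Let hm := bf_m bf.
Let hr := bf_r bf.
Let hs := bf_s bf.
Let uP := bf_unit bf.

Let ww : w * w = n%:M.
Proof. by rewrite mx2M mx2C /n /norm2; congr mx2; ring. Qed.

Let uw : w \is a GRing.unit.
Proof. by rewrite mx2_unit; move: n0; rewrite -oppr_eq0 /n /norm2; congr (_ != 0); ring. Qed.

Let wV : w^-1 = n^-1 *: w.
Proof. by apply: mx_inv_eq; rewrite -scalerAl ww scale_scalar_mx mulVf. Qed.

Let decomp x : exists a b c d, x = quad l m a b + toprow r s * quad l m c d.
Proof.
rewrite (mx2E x); move: (x 0 0) (x 0 1) (x 1 0) (x 1 1) => a b c d.
pose h := a - c * l - d; pose k := b - c * m.
exists c, d, ((h * s - k * r) / n), ((k * (s + r * l) - h * r * m) / n).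
rewrite -(toprow_div h k n0) /h /k.
by rewrite mx2D; congr mx2; ring.
Qed.

Let tr1 a b c d : \tr (w^-1 * (quad l m a b + toprow r s * quad l m c d)) = c.
Proof.
rewrite wV toprow_quadM !mx2_simp mx2_tr; move: n0; rewrite /n /norm2 => n0'; field.
exact: n0'.
Qed.

Let tr2 a b c d e f :
  \tr (w^-1 * (quad l m a b + toprow r s * quad l m c d) * (toprow r s * quad l m e f)) =
  e * b - f * a + (r * (c * l + d) + s * c) * e.
Proof.
rewrite wV !toprow_quadM !mx2_simp mx2_tr; move: n0; rewrite /n /norm2 => n0'; field.
exact: n0'.
Qed.

Let R0in a b c d : O a -> O b -> O c -> O d ->
  R0 (quad l m a b + toprow r s * quad l m c d).
Proof. by move=> *; apply/(bf_eq bf); exists a, b, c, d. Qed.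

Let R0V x : R0 x -> mxV O x.
Proof.
move=> /(bf_eq bf)[a [b [c [d [ha hb hc hd ->]]]]].
rewrite toprow_quadM mx2D; apply/mxV_mx2; move: hl hm hr hs => ? ? ? ?; split; vr_closed hO.
Qed.

Let sR0 : subalg v R0.
Proof. exact: conjR_subalg uP (order_subalg hv fR.1). Qed.

(** If w x is in R0, tr(x y) is the coordinate c of w x y. Conversely, pairing x with 1, C, e12 rho
    and e12 rho C gives the coordinates c, d, -a and b of w x, up to terms already known to be
    integral. *)
Let codiffl x : codifferent O R0 x <-> R0 (w * x).
Proof.
have [_ _ RM _] := sR0; have v1 := vr1 hO; have v0 := vr0 hO.
have xE : x = w^-1 * (w * x) by rewrite mulKr.
split=> [h|Rx y Ry]; last first.
  rewrite xE -mulrA; have /(bf_eq bf)[a [b [c [d [_ _ hc _ ->]]]]] := RM _ _ Rx Ry.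
  by rewrite tr1.
have [a [b [c [d e]]]] := decomp (w * x); rewrite e in xE *.
have hc : O c.
  have /h : R0 1 by case: sR0.
  by rewrite mulr1 xE tr1.
have hd : O d.
  have /h : R0 (quad l m 1 0 + toprow r s * quad l m 0 0) by apply: R0in.
  rewrite xE -mulrA.
  have -> : (quad l m a b + toprow r s * quad l m c d) *
      (quad l m 1 0 + toprow r s * quad l m 0 0) =
      quad l m (a * l + b) (a * m) + toprow r s * quad l m (c * l + d) (c * m).
    by rewrite !toprow_quadM !mx2_simp; congr mx2; ring.
  rewrite tr1 => hh; have -> : d = c * l + d - c * l by ring.
  by move: hl => ?; vr_closed hO.
have T e' f : O e' -> O f -> R0 (toprow r s * quad l m e' f).
  move=> he hf; have := R0in v0 v0 he hf; congr R0.
  by rewrite !toprow_quadM !mx2D; congr mx2; ring.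
have ha : O a.
  have := h _ (T _ _ v0 v1); rewrite xE tr2 => hh.
  by have := vrN hO hh; congr O; ring.
have hb : O b.
  have := h _ (T _ _ v1 v0); rewrite xE tr2 => hh.
  have -> : b = 1 * b - 0 * a + (r * (c * l + d) + s * c) * 1 - (r * (c * l + d) + s * c).
    by ring.
  by move: hl hr hs => ? ? ?; vr_closed hO.
exact: R0in.
Qed.

(** The adjugate preserves R0 and its codifferent, reverses products and sends w to -w, so it
    carries [codiffl] to the other side. *)
Let codiffr x : codifferent O R0 x <-> R0 (x * w).
Proof.
have [R1 RD RM RZ] := sR0.
have trO y : R0 y -> O (\tr y).
  by move=> /R0V hy; rewrite (mx2E y) mx2_tr; apply: (vrD hO).
have RN y : R0 y -> R0 (- y).
  by move=> Ry; rewrite -scaleN1r; apply: RZ => //; vr_closed hO.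
have Radj y : R0 y -> R0 (adj2 y).
  move=> Ry; apply: RD; last exact: RN.
  by rewrite -scalemx1; apply: RZ => //; apply: trO.
have aw : adj2 w = - w by rewrite adj2_mx2 mx2N; congr mx2; ring.
split=> h.
  have /codiffl/Radj/RN : codifferent O R0 (adj2 x) by apply: codifferent_adj2.
  by rewrite adj2M adj2K aw mulrN opprK.
rewrite -(adj2K x); apply: codifferent_adj2 => //; apply/codiffl.
by have := RN _ (Radj _ h); rewrite adj2M aw mulNr opprK.
Qed.

Lemma basic_Gorenstein : Gorenstein O R.
Proof.
have cod x : codifferent O R x <-> codifferent O R0 (P^-1 * x * P).
  split=> h y Ry.
    by have := h _ Ry; rewrite -(tr_conj (P^-1 * x * P * y) uP) !mulrA mulrV // mul1r.
  have /h : R0 (P^-1 * y * P) by rewrite /R0 /conjR mx_conjK.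
  rewrite !mulrA mulrK // -(mulrA P^-1) -{2}(invrK P) tr_conj //.
  by rewrite unitrV.
apply: (Gorenstein_of_generator hO (u := P * w^-1 * P^-1)) => //.
- by rewrite !mx_unitM !unitrV uP uw.
- move=> x; rewrite cod codiffl /R0 /conjR.
  rewrite !invrM ?mx_unitM ?unitrV ?uP ?uw // !invrK.
  by rewrite !mulrA mulrK.
- move=> x; rewrite cod codiffr /R0 /conjR.
  rewrite !invrM ?mx_unitM ?unitrV ?uP ?uw // !invrK.
  by rewrite !mulrA mulrV // mul1r.
Qed.

End Basic.

(** Avoiding all O + pi P M P^-1 is inherited by larger orders, so each of them has a basic form. *)
Lemma not_scal_mod_Bass R : full_order O R -> not_scal_mod v pi R -> Bass O R.
Proof.
move=> fR nR; split=> // R' hR' RR'.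
have fR' : full_order O R'.
  split=> // a; have [n [r [k [h e]]]] := fR.2 a.
  by exists n, r, k; split=> // i; apply: RR'.
have nR' : not_scal_mod v pi R'.
  by move=> P uP h; apply: (nR P uP) => x /RR'/h.
have [P [l [m [r [s bf]]]]] := basic_form_exists hv pi0 vpi fR' nR'.
exact: basic_Gorenstein bf.
Qed.

Lemma scal_mod_order t P : O t -> P \is a GRing.unit -> is_order O (scal_mod v t P).
Proof.
move=> ht uP; have [M1 MD MN MM [g hg]] := conjM_order hO uP.
have MZ := order_scale hO (conjM_order hO uP).
have M0 : conjM O P 0 by rewrite -(subrr 1); apply: (MD) => //; apply: (MN).
split.
- by exists 1, 0; split; [apply: (vr1 hO)| |rewrite scaler0 addr0].
- move=> _ _ [c [m [hc hm ->]]] [d [k [hd hk ->]]]; exists (c + d), (m + k).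
  by split; [vr_closed hO|apply: (MD)|rewrite scalerDr raddfD /= addrACA].
- move=> _ [c [m [hc hm ->]]]; exists (- c), (- m).
  by split; [vr_closed hO|apply: (MN)|rewrite scalerN raddfN /= opprD].
- move=> _ _ [c [m [hc hm ->]]] [d [k [hd hk ->]]].
  exists (c * d), (c *: k + d *: m + t *: (m * k)); split; first by vr_closed hO.
    by apply: (MD); [apply: (MD)|]; apply: (MZ) => //; apply: (MM).
  rewrite (mx2E m) (mx2E k); move: (m 0 0) (m 0 1) (m 1 0) (m 1 1) => m0 m1 m2 m3.
  move: (k 0 0) (k 0 1) (k 1 0) (k 1 1) => k0 k1 k2 k3.
  by rewrite !mx2_simp; congr mx2; ring.
exists (1 :: [seq t *: x | x <- g]) => x; rewrite O_spanP //=; split.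
  move=> [c [m [hc /hg/(O_spanP hO)[k [hk ->]] ->]]].
  exists (fun i => if i is j.+1 then k j else c); split; first by case.
  rewrite size_map big_ord_recl /= scalemx1 scaler_sumr; congr (_ + _).
  by apply: eq_bigr => i _; rewrite add0n (nth_map 0) ?ltn_ord // !scalerA mulrC.
move=> [k [hk ->]]; exists (k 0%N), (\sum_(i < size g) k i.+1 *: g`_i); split=> //.
  by apply/hg/O_spanP => //; exists (fun i => k i.+1).
rewrite size_map big_ord_recl /= scalemx1 scaler_sumr; congr (_ + _).
by apply: eq_bigr => i _; rewrite add0n (nth_map 0) ?ltn_ord // !scalerA mulrC.
Qed.

(* The codifferent of O + pi M is contained in pi^-1 M, and anything multiplying it into
   O + pi M lies in pi^2 M, so their product misses 1. *)
Lemma Bass_not_scal_mod R : Bass O R -> not_scal_mod v pi R.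
Proof.
move=> [fR hB] P uP RS.
have Opi := O_pi vpi.
have [_ [_ [J' [_ h1 _]]]] := hB _ (scal_mod_order Opi uP) RS.
have v1 := vr1 hO; have v0 := vr0 hO.
pose S := scal_mod v pi P.
pose C a b c d := P * mx2 a b c d * P^-1.
have Cj a b c d : P^-1 * C a b c d * P = mx2 a b c d by rewrite mx_conjVK.
(* Trace zero kills the scalar part of an element of O + pi M, and pi^-1 cancels the pi of the
   rest. *)
have cod a b c d : a + d = 0 -> O a -> O b -> O c -> O d ->
    codifferent O S (pi^-1 *: C a b c d).
  move=> ad ha hb hc hd _ [k [m [hk hm ->]]].
  rewrite mulrDr -scalemx1 -!scalerAr mulr1 -scalerAl !scalerA mulfV // scale1r.
  rewrite raddfD /= !mxtraceZ /C tr_conj // mx2_tr ad !mulr0 add0r.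
  have -> : P * mx2 a b c d * P^-1 * m = P * (mx2 a b c d * (P^-1 * m * P)) * P^-1.
    by rewrite !mulrA mulrK.
  rewrite tr_conj //; move: hm; rewrite /conjM; move: (P^-1 * m * P) => x.
  rewrite (mx2E x) mx2M mx2_tr => /mxV_mx2[? ? ? ?]; vr_closed hO.
have inJ' j : J' j -> mxV O (pi^-1 *: (pi^-1 *: (P^-1 * j * P))).
  move=> Jj.
  have pr a : codifferent O S a -> S (a * j).
    move=> ha; apply/h1; exists 1%N, (fun=> a), (fun=> j); split; last by rewrite big_ord1.
    by move=> _; split.
  have e a b c d : P^-1 * (pi^-1 *: C a b c d * j) * P = pi^-1 *: (mx2 a b c d * (P^-1 * j * P)).
    by rewrite -scalerAl -scalerAr -scalerAl /C !mulrA mulVr // mul1r.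
  have /pr := cod 0 1 0 0 (addr0 0) v0 v1 v0 v0.
  have /pr := cod 0 0 1 0 (addr0 0) v0 v0 v1 v0.
  rewrite /S !scal_modP // !e.
  move: (P^-1 * j * P) => x; rewrite (mx2E x).
  move: (x 0 0) (x 0 1) (x 1 0) (x 1 1) => a b c d.
  rewrite !mx2M !mx2Z !mx2_entries => -[_ _ k1 k2] [_ k3 _ k4].
  apply/mxV_mx2; split.
  - by move: k1; congr O; field.
  - by have := vrN hO k2; congr O; field.
  - by move: k4; congr O; field.
  - by move: k3; congr O; field.
have inJ a : codifferent O S a -> mxV O (pi *: (P^-1 * a * P)).
  move=> ha.
  have pr b c d e : O b -> O c -> O d -> O e -> O (\tr (a * (pi *: C b c d e))).
    move=> *; apply: ha; exists 0, (C b c d e); split=> //.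
      by rewrite /conjM Cj; apply/mxV_mx2.
    by rewrite raddf0 add0r.
  have e b c d f : \tr (a * (pi *: C b c d f)) = pi * \tr ((P^-1 * a * P) * mx2 b c d f).
    rewrite -scalerAr mxtraceZ /C -(tr_conj (P^-1 * a * P * mx2 b c d f) uP).
    by rewrite !mulrA mulrV // mul1r.
  have := pr _ _ _ _ v1 v0 v0 v0; have := pr _ _ _ _ v0 v1 v0 v0.
  have := pr _ _ _ _ v0 v0 v1 v0; have := pr _ _ _ _ v0 v0 v0 v1; rewrite !e.
  move: (P^-1 * a * P) => x; rewrite (mx2E x).
  move: (x 0 0) (x 0 1) (x 1 0) (x 1 1) => b c d f.
  rewrite !mx2M !mx2_tr mx2Z => k1 k2 k3 k4; apply/mxV_mx2; split.
  - by move: k4; congr O; ring.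
  - by move: k2; congr O; ring.
  - by move: k3; congr O; ring.
  - by move: k1; congr O; ring.
have /h1[n [a [b [hab e1]]]] : S 1 by case: (scal_mod_order Opi uP).
have : mxV O (pi^-1 *: (1 : 'M[K]_2)).
  have -> : pi^-1 *: (1 : 'M[K]_2) = \sum_(i < n)
      (pi *: (P^-1 * a i * P)) * (pi^-1 *: (pi^-1 *: (P^-1 * b i * P))).
    rewrite -[1](mulVr uP) -[X in X * P]mulr1 e1 mulr_sumr mulr_suml scaler_sumr.
    apply: eq_bigr => i _.
    by rewrite -!scalerAr -!scalerAl !scalerA !mulrA mulrK // mulfVK.
  by apply: (mxV_sum hO) => i _; have [ha hb] := hab i; apply: (mxVM hO); [apply: inJ|apply: inJ'].
rewrite mx2_1 mx2Z => /mxV_mx2[+ _ _ _].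
rewrite mulr1 /valring vgeE ?invr_eq0 // (val_inv hv) // vpi; lia.
Qed.

End Bass.

(** * Ghost intersections *)

Lemma seq_choice (T U : Type) (x0 : T) (u0 : U) (rel : T -> U -> Prop) (s : seq T) :
  (forall i, (i < size s)%N -> exists u, rel (nth x0 s i) u) ->
  exists t, size t = size s /\ forall i, (i < size s)%N -> rel (nth x0 s i) (nth u0 t i).
Proof.
elim: s => [|a s IH] h; first by exists [::].
have [t [st ht]] := IH (fun i => h i.+1).
have [u hu] := h 0%N isT.
by exists (u :: t); split=> [|[|i]] //=; [rewrite st|apply: ht].
Qed.

Lemma quadratic_splits (K : fieldType) (l m : K) : exists (L : fieldExtType K) (a b : L),
  a + b = in_alg L l /\ a * b = - in_alg L m.
Proof.
suff [L [a e]] : exists (L : fieldExtType K) (a : L),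
    a * a = in_alg L l * a + in_alg L m.
  exists L, a, (in_alg L l - a); split; first by rewrite addrC subrK.
  by rewrite mulrBr e; ring.
pose p : {poly K} := 'X^2 - (l *: 'X + m%:P).
have sq : (size (l *: 'X + m%:P)%R < size ('X^2 : {poly K})%R)%N.
  rewrite size_polyXn ltnS (leq_trans (size_polyD _ _)) // geq_max.
  rewrite (leq_trans (size_scale_leq _ _)) ?size_polyX //=.
  by rewrite (leq_trans (size_polyC_leq1 _)).
have sp : size p = 3.
  by rewrite size_polyDl ?size_polyXn // size_polyN -(size_polyXn K 2).
have rootE (L : fieldExtType K) (a : L) : root (map_poly (in_alg L) p) a ->
    a * a = in_alg L l * a + in_alg L m.
  rewrite rmorphB rmorphD /= map_polyXn map_polyZ map_polyX map_polyC /=.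
  by rewrite /root !hornerE subr_eq0 => /eqP.
(* With a root in K an extension of degree 1 is enough; adjoining a root of X supplies one. *)
case: (classic (exists x, root p x)) => [[x rx]|no].
  have [|L _ [z _ _]] := @irredp_FAdjoin K 'X.
    by rewrite -(subr0 'X) -polyC0; apply: irredp_XsubC.
  by exists L, (in_alg L x); apply: rootE; rewrite fmorph_root.
have irr : irreducible_poly p.
  apply: cubic_irreducible; first by rewrite sp.
  by move=> x; apply/negP => rx; apply: no; exists x.
by have [L _ [z rz _]] := irredp_FAdjoin irr; exists L, z; apply: rootE.
Qed.

(** * Membership in the maximal order attached to a ball *)

Section Ball.
Variables (F : fieldType) (V : F -> Prop).
Hypothesis hV : valuation_ring V.
Variables (a b c d : F).
Hypothesis hg : mxV V (mx2 a b c d).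

(** In the basis (r, 0), (p, 1) the upper right entry of g is phi_g(p) / r, and the other three are
    integral because g, p and r are. *)
Lemma conjM_ball p r : V p -> V r -> r != 0 ->
  conjM V (mx2 r p 0 1) (mx2 a b c d) <-> V ((b + (a - d) * p - c * p * p) / r).
Proof.
move=> hp hr r0; move/mxV_mx2: hg => [ha hb hc hd].
rewrite /conjM (@mx_inv_eq _ _ (mx2 r^-1 (- p / r) 0 1)); last first.
  by rewrite mx2M mx2_1; congr mx2; field.
rewrite !mx2M.
have -> : mx2 ((r^-1 * a + - p / r * c) * r + (r^-1 * b + - p / r * d) * 0)
    ((r^-1 * a + - p / r * c) * p + (r^-1 * b + - p / r * d) * 1)
    ((0 * a + 1 * c) * r + (0 * b + 1 * d) * 0) ((0 * a + 1 * c) * p + (0 * b + 1 * d) * 1) =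
    mx2 (a - p * c) ((b + (a - d) * p - c * p * p) / r) (c * r) (c * p + d).
  by congr mx2; field.
rewrite mxV_mx2; split=> [[]//|h]; split=> //.
- by apply: (vrB hV) => //; apply: (vrM hV).
- exact: (vrM hV).
- by apply: (vrD hV) => //; apply: (vrM hV).
Qed.

(** The ball around infinity: evaluated at the vector (1, 0), the form phi_g is -c. *)
Lemma conjM_diag r : V r -> r != 0 ->
  conjM V (mx2 1 0 0 r) (mx2 a b c d) <-> V (c / r).
Proof.
move=> hr r0; move/mxV_mx2: hg => [ha hb hc hd].
rewrite /conjM (@mx_inv_eq _ _ (mx2 1 0 0 r^-1)); last first.
  by rewrite mx2M mx2_1; congr mx2; field.
have -> : mx2 1 0 0 r^-1 * mx2 a b c d * mx2 1 0 0 r = mx2 a (b * r) (c / r) d.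
  by rewrite !mx2M; congr mx2; field.
by rewrite mxV_mx2; split=> [[]//|h]; split=> //; apply: (vrM hV).
Qed.

End Ball.

(** * The two implications *)

Section Main.
Variables (K : fieldType) (v : K -> int).
Hypothesis hK : nonarch_local_field v.
Let hv : is_discrete_valuation v. Proof. by case: hK. Qed.
Let hc : v_complete v. Proof. by case: hK. Qed.
Local Notation O := (valring v).
Let hO : valuation_ring O := valring_valuation hv.

(** Membership in R is tested in each [D i] separately. After conjugation by Q, which makes m and m'
    integral matrices, each test is an instance of [conjM_scaled_mul] over L. *)
Lemma ghost_scaled_mul R Q c m m' : ghost_intersection v R -> Q \is a GRing.unit ->
  O c -> conjM O Q m -> conjM O Q m' -> R (c *: m) -> R (c *: m') -> R (c *: (m * m')).
Proof.
move=> [L [n [D [_ hD hR]]]] uQ Oc Vm Vm' /hR Rm /hR Rm'; apply/hR => i.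
have hV : valuation_ring (@int_closure K v L) by apply: int_closure_valuation_ring.
have [P uP DP] := maximal_orderP hV (hD i).
have {}Rm := (DP _).1 (Rm i); have {}Rm' := (DP _).1 (Rm' i); apply/DP.
pose f := map_mx (in_alg L) : 'M[K]_2 -> 'M[L]_2.
have fM (x y : 'M[K]_2) : f (x * y) = f x * f y by apply: map_mxM.
have fZ k x : f (k *: x) = in_alg L k *: f x by apply: map_mxZ.
have f1 : f 1 = 1 by apply: map_mx1.
have QQ : f Q^-1 * f Q = 1 by rewrite -fM mulVr.
have ufQ : f Q \is a GRing.unit by have [] := mulmx1_unit QQ.
have fV : f Q^-1 = (f Q)^-1 by rewrite (mx_inv_eq QQ).
have Vf x : conjM O Q x -> mxV (@int_closure K v L) ((f Q)^-1 * f x * f Q).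
  move=> h; rewrite -fV -!fM => j k; rewrite mxE; apply/int_closure_in_alg => //.
have uW : (f Q)^-1 * P \is a GRing.unit by rewrite mx_unitM unitrV ufQ.
have cj k x : conjM (@int_closure K v L) P (f (k *: x)) <->
    conjM (@int_closure K v L) ((f Q)^-1 * P) (in_alg L k *: ((f Q)^-1 * f x * f Q)).
  rewrite /conjM invrM ?unitrV // invrK fZ -!scalerAr -!scalerAl.
  have -> : P^-1 * f Q * ((f Q)^-1 * f x * f Q) * ((f Q)^-1 * P) = P^-1 * f x * P.
    by rewrite !mulrA !mulrK // mulrVK.
  by [].
have {}Rm := (cj c m).1 Rm; have {}Rm' := (cj c m').1 Rm'.
apply: (cj c (m * m')).2.
have -> : (f Q)^-1 * f (m * m') * f Q =
    ((f Q)^-1 * f m * f Q) * ((f Q)^-1 * f m' * f Q).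
  by rewrite fM !mulrA mulrK.
apply: conjM_scaled_mul => //; try exact: Vf.
exact/int_closure_in_alg.
Qed.

Lemma nz_ideal_principal I : nz_ideal O I -> exists c, [/\ c != 0, O c &
  forall x, I x <-> O (x / c)].
Proof.
move=> [IO I0 ID IM [x0 [Ix0 x00]]].
have [|c [Ic c0] cmin] := @exists_argmin _ (fun x => I x /\ x != 0) (fun x => `|v x|%N).
  by exists x0.
have Oc := IO _ Ic; exists c; split=> // x; split=> [Ix|h]; last first.
  by have -> : x = x / c * c by [rewrite mulfVK]; apply: IM.
have [->|xn0] := eqVneq x 0; first by rewrite mul0r; vr_closed hO.
apply/vge_div => //; rewrite vgeE //; have := cmin _ (conj Ix xn0).
have := IO _ Ix; move: Oc; rewrite /valring !vgeE //.
by move: (v x) (v c) => ? ?; lia.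
Qed.

Variable pi : K.
Hypotheses (pi0 : pi != 0) (vpi : v pi = 1).

(** R contains c e12 and d e21 with c d nonzero. If R lies in O + t Q M Q^-1, their commutator is
    t^2 times an element of Q M Q^-1, so t^4 divides its determinant -(c d)^2; this bounds k. *)
Lemma max_scal_mod R : full_order O R -> exists k,
  (exists2 Q, Q \is a GRing.unit & forall x, R x -> scal_mod v (pi ^+ k) Q x) /\
  ~ (exists2 Q, Q \is a GRing.unit & forall x, R x -> scal_mod v (pi ^+ k.+1) Q x).
Proof.
move=> fR; pose A k := exists2 Q, Q \is a GRing.unit & forall x, R x -> scal_mod v (pi ^+ k) Q x.
have A0 : A 0%N.
  have [Q uQ hQ] := order_in_conj hO fR.1; exists Q => // x /hQ h.
  by exists 0, x; split; [vr_closed hO|by []|rewrite expr0 scale1r raddf0 add0r].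
have [c [c0 _ Rc]] := full_scale hv fR (mx2 0 1 0 0).
have [d [d0 _ Rd]] := full_scale hv fR (mx2 0 0 1 0).
have cd0 : c * d * (c * d) != 0 by rewrite !mulf_neq0.
have bnd k : A k -> (k%:Z <= v (c * d * (c * d))).
  move=> [Q uQ hQ].
  have [a [m [_ Vm e]]] := hQ _ Rc; have [b [m' [_ Vm' e']]] := hQ _ Rd.
  have t0 : pi ^+ k != 0 by rewrite expf_neq0.
  set t := pi ^+ k in e e' t0.
  have comm : (c *: mx2 0 1 0 0) * (d *: mx2 0 0 1 0) - (d *: mx2 0 0 1 0) * (c *: mx2 0 1 0 0)
      = (t * t) *: (m * m' - m' * m).
    rewrite e e' (mx2E m) (mx2E m'); move: (m 0 0) (m 0 1) (m 1 0) (m 1 1) => m0 m1 m2 m3.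
    move: (m' 0 0) (m' 0 1) (m' 1 0) (m' 1 1) => k0 k1 k2 k3.
    by rewrite !mx2_simp; congr mx2; ring.
  have [w [hw ew]] : exists w, O w /\ c * d * (c * d) = - (t * t * (t * t) * w).
    exists (\det (m * m' - m' * m)); split.
      rewrite -(det_conj _ (P := Q^-1)) ?unitrV // invrK.
      have : mxV O (Q^-1 * (m * m' - m' * m) * Q).
        have [_ MD MN MM _] := conjM_order hO uQ.
        by apply: (MD); [|apply: (MN)]; apply: (MM).
      move: (_ * _ * _) => x Vx; rewrite (mx2E x) mx2_det.
      by move: (Vx 0 0) (Vx 0 1) (Vx 1 0) (Vx 1 1) => *; vr_closed hO.
    have := congr1 (fun x : 'M_2 => - \det x) comm.
    rewrite detZ !mx2_simp mx2_det => h; rewrite -[t * t * (t * t)]/((t * t) ^+ 2) -h; ring.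
  have w0 : w != 0.
    by apply/eqP => w0; move: cd0; rewrite ew w0 mulr0 oppr0 eqxx.
  rewrite ew (val_opp hv) !(val_mul hv) ?mulf_neq0 //.
  have -> : v t = k%:Z by rewrite /t (val_exp hv) // vpi natz.
  move: hw; rewrite /valring vgeE //; move: (v w) => ?; lia.
have [|k Ak kmin] := @exists_argmin _ A (fun k => `|v (c * d * (c * d))| - k)%N.
  by exists 0%N.
exists k; split=> // Ak1; have := kmin _ Ak1; have := bnd _ Ak1.
by move: (v _) => z; lia.
Qed.

Lemma ghost_Bass_closure R : full_order O R -> ghost_intersection v R ->
  exists Rt, gor_closure O R Rt /\ Bass O Rt.
Proof.
move=> fR gR; have hR := fR.1; have [R1 RD RM RZ] := order_subalg hv hR.
have [k [[Q uQ hQ] nk]] := max_scal_mod fR.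
have Opi := O_pi vpi.
have t0 : pi ^+ k != 0 by rewrite expf_neq0.
have Ot : O (pi ^+ k).
  by elim: k {hQ nk t0} => [|k IH]; rewrite ?expr0 ?exprS; vr_closed hO.
set t := pi ^+ k in hQ t0 Ot.
have [M1 MD MN MM [g hg]] := conjM_order hO uQ.
have MZ := order_scale hO (conjM_order hO uQ).
have MC c : conjM O Q c%:M <-> O c.
  rewrite /conjM -scalemx1 -scalerAr mulr1 -scalerAl mulVr // scalemx1 mx2C mxV_mx2.
  by split=> [[]//|hh]; split=> //; vr_closed hO.
pose Rt m := conjM O Q m /\ R (t *: m).
have RQ x : R x -> conjM O Q x.
  move=> /hQ[c [m [cO Vm ->]]]; apply: (MD); first exact/MC.
  exact: (MZ).
have RC c : O c -> R c%:M by apply: order_scalar.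
have RN x : R x -> R (- x) by move=> h; rewrite -scaleN1r; apply: (RZ) => //; vr_closed hO.
have RtO : is_order O Rt.
  split.
  - by split=> //; apply: RZ.
  - by move=> x y [? ?] [? ?]; split; [apply: (MD)|rewrite scalerDr; apply: RD].
  - by move=> x [? ?]; split; [apply: (MN)|rewrite scalerN; apply: RN].
  - move=> x y [? ?] [? ?]; split; first exact: (MM).
    exact: (ghost_scaled_mul gR uQ).
  have [s hs] : fg_submodule O R by case: hR.
  (* Each generator of R is an integral scalar plus t m; these m and 1 generate [Rt]. *)
  have [i _|ms [sms hms]] := @seq_choice _ _ 0 0
      (fun x m => conjM O Q m /\ exists2 c, O c & x - t *: m = c%:M) s.
    have [c [m [? ? ->]]] := hQ _ ((hs _).2 (O_span_nth hO s i)).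
    by exists m; split=> //; exists c => //; rewrite addrK.
  have gen i : (i < size s)%N -> Rt ms`_i.
    move=> /hms[h [c cO e]]; split=> //.
    have -> : t *: ms`_i = s`_i - c%:M by rewrite -e opprB addrC subrK.
    by apply: RD; [apply/hs/O_span_nth|apply: RN; apply: RC].
  exists (1 :: ms) => m; rewrite O_spanP //= sms; split.
    move=> [Vm /hs/(O_spanP hO)[c [cO e]]].
    have VS : conjM O Q (\sum_(i < size s) c i *: ms`_i).
      apply: (big_ind (conjM O Q)) => //; first by rewrite -(subrr 1); apply: (MD) => //; apply: (MN).
      by move=> i _; apply: (MZ) => //; case: (gen i (ltn_ord i)).
    have [y ye] : exists y, t *: (m - \sum_(i < size s) c i *: ms`_i) = y%:M.
      rewrite scalerBr e scaler_sumr -sumrB.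
      apply: (big_ind (fun x => exists y, x = y%:M)).
      - by exists 0; rewrite raddf0.
      - by move=> _ _ [y ->] [z ->]; exists (y + z); rewrite raddfD.
      - move=> i _; have [_ [z _ ez]] := hms i (ltn_ord i); exists (c i * z).
        by rewrite scalerA [t * _]mulrC -scalerA -scalerBr ez scale_scalar_mx.
    (* The difference is scalar because its multiple by t is; it will be integral because it lies in
       Q M Q^-1. *)
    have me : m - \sum_(i < size s) c i *: ms`_i = (t^-1 * y)%:M.
      by rewrite -scale_scalar_mx -ye scalerA mulVf // scale1r.
    exists (fun i => if i is j.+1 then c j else t^-1 * y); split.
      case=> [|i] //; apply/MC; rewrite -me; apply: (MD) => //; exact: (MN).
    rewrite big_ord_recl /= scalemx1 -me -[LHS](subrK (\sum_(i < size s) c i *: ms`_i)).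
    by congr (_ + _).
  move=> [c [cO ->]].
  have RtD x y : Rt x -> Rt y -> Rt (x + y).
    by move=> [? ?] [? ?]; split; [apply: (MD)|rewrite scalerDr; apply: RD].
  have RtZ a x : O a -> Rt x -> Rt (a *: x).
    move=> ha [? ?]; split; first exact: (MZ).
    by rewrite scalerA mulrC -scalerA; apply: RZ.
  have Rt1 : Rt 1 by split=> //; apply: RZ.
  apply: (big_ind Rt) => //; first by rewrite -(scale0r 1); apply: RtZ => //; vr_closed hO.
  move=> [[|i] hi] _ /=; apply: RtZ => //; exact: gen.
have RRt x : R x -> Rt x by move=> Rx; split; [apply: RQ|apply: RZ].
have fRt : full_order O Rt.
  split=> // a; have [n [r [c [h e]]]] := fR.2 a.
  by exists n, r, c; split=> // i; apply: RRt.
(* If [Rt] were in O + pi P M P^-1, then R would be in O + pi^(k+1) P M P^-1. *)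
have nRt : not_scal_mod v pi Rt.
  move=> P uP h; apply: nk; exists P => // x Rx.
  have [c [m [cO Vm xE]]] := hQ _ Rx.
  have /h[c' [m' [cO' Vm' mE]]] : Rt m.
    split=> //; have -> : t *: m = x - c%:M by rewrite xE addrC addKr.
    by apply: RD => //; apply: RN; apply: RC.
  exists (c + t * c'), m'; split=> //; first by vr_closed hO.
  rewrite xE mE scalerDr scale_scalar_mx scalerA raddfD /= addrA exprSr.
  by [].
have bRt := not_scal_mod_Bass hv pi0 vpi fRt nRt.
exists Rt; split=> //; split; first by apply: bRt.2 => //; exact: RtO.
exists (fun x => O (x / t)); split.
  split.
  - move=> x h; have -> : x = x / t * t by rewrite mulfVK.
    by vr_closed hO.
  - by rewrite mul0r; vr_closed hO.
  - by move=> x y ? ?; rewrite mulrDl; vr_closed hO.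
  - by move=> a x ? ?; rewrite -mulrA; vr_closed hO.
  - by exists t; rewrite mulfV //; split=> //; vr_closed hO.
move=> z; split.
  move=> Rz; have [c [m [cO Vm zE]]] := hQ _ Rz.
  exists c, (t *: m); split=> //.
  exists 1%N, (fun=> t), (fun=> m); split; last by rewrite big_ord1.
  move=> _; split; first by rewrite mulfV //; vr_closed hO.
  split=> //; have -> : t *: m = z - c%:M by rewrite zE addrC addKr.
  by apply: RD => //; apply: RN; apply: RC.
move=> [c [y [cO [n [d [x [h ->]]]] ->]]]; apply: (RD); first exact: RC.
apply: (big_ind R) => //; first by rewrite -(scale0r 1); apply: (RZ) => //; vr_closed hO.
move=> i _; have [hd hx] := h i.
have <- : (d i / t) *: (t *: x i) = d i *: x i by rewrite scalerA mulfVK.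
by apply: (RZ) => //; exact: hx.2.
Qed.

Lemma gor_closureE R Rt : Bass O Rt -> gor_closure O R Rt -> exists c, [/\ c != 0, O c &
  forall z, R z <-> exists k x, [/\ O k, Rt x & z = k%:M + c *: x]].
Proof.
move=> [[hRt _] _] [_ [I [nzI RE]]].
have [c [c0 Oc IE]] := nz_ideal_principal nzI.
have [R1 RD RM RZ] := order_subalg hv hRt.
exists c; split=> // z; rewrite RE; split.
  move=> [k [y [hk [n [d [x [h ->]]]] ->]]].
  exists k, (\sum_(i < n) (d i / c) *: x i); split=> //.
    apply: (big_ind Rt) => //; first by rewrite -(scale0r 1); apply: (RZ) => //; vr_closed hO.
    by move=> i _; have [/IE hd hx] := h i; apply: (RZ).
  congr (_ + _); rewrite scaler_sumr; apply: eq_bigr => i _.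
  by rewrite scalerA mulrC mulfVK.
move=> [k [x [hk hx ->]]]; exists k, (c *: x); split=> //.
exists 1%N, (fun=> c), (fun=> x); split; last by rewrite big_ord1.
by move=> _; split=> //; apply/IE; rewrite mulfV //; vr_closed hO.
Qed.

Lemma Bass_closure_ghost R Rt : Bass O Rt -> gor_closure O R Rt -> ghost_intersection v R.
Proof.
move=> bRt /(gor_closureE bRt)[c [c0 Oc RE]].
have nRt := Bass_not_scal_mod hv pi0 vpi bRt.
have [P [l [m [r [s bf]]]]] := basic_form_exists hv pi0 vpi bRt.1 nRt.
have [uP hl hm gd hr hs n0 hRt] := bf.
have [L [a [b [eab pab]]]] := quadratic_splits l m.
set V := @int_closure K v L.
have hV : valuation_ring V by apply: int_closure_valuation_ring.
have OV x : V (in_alg L x) <-> O x by apply: int_closure_in_alg.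
have [V1 V0] := (vr1 hV, vr0 hV).
pose i := in_alg L.
have {}eab : a + b = i l := eab.
have {}pab : a * b = - i m := pab.
have {}OV x : V (i x) <-> O x := OV x.
have iD x y : i (x + y) = i x + i y by rewrite /i rmorphD.
have iM x y : i (x * y) = i x * i y by rewrite /i rmorphM.
have iN x : i (- x) = - i x by rewrite /i rmorphN.
have iV x : i x^-1 = (i x)^-1 by rewrite /i fmorphV.
have i1 : i 1 = 1 by rewrite /i rmorph1.
have i0 : i 0 = 0 by rewrite /i rmorph0.
have in0 x : x != 0 -> i x != 0 by rewrite /i fmorph_eq0.
have root_int x : x * x = i l * x + i m -> V x.
  move=> ex; case: (vr_total hV x) => // hx.
  have [->|x0] := eqVneq x 0; first exact: (vr0 hV).
  have -> : x = i l + i m * x^-1.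
    by apply: (mulIf x0); rewrite ex mulrDl mulfVK.
  by apply: (vrD hV); [|apply: (vrM hV) => //]; apply/OV.
have ea : a * a = i l * a + i m.
  by rewrite -[i m]opprK -pab -eab; ring.
have eb : b * b = i l * b + i m.
  by rewrite -[i m]opprK -pab -eab; ring.
have [Va Vb] : V a /\ V b by split; apply: root_int.
(* For z = a or b this is the eigenvalue of x C + y on (z, 1). *)
pose ev x y z := i x * z + i y.
have evV x y z : O x -> O y -> V z -> V (ev x y z).
  by move=> *; apply: (vrD hV); [apply: (vrM hV) => //|]; apply/OV.
have evN : ev r s a * ev r s b = i (norm2 l m r s).
  rewrite /norm2 /ev !(iD, iM, iN) -/i.
  have -> : (i r * a + i s) * (i r * b + i s) =
      i r * i r * (a * b) + i r * i s * (a + b) + i s * i s by ring.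
  by rewrite pab eab -/i; ring.
have [ra0 rb0] : ev r s a != 0 /\ ev r s b != 0.
  by move: (in0 _ n0); rewrite -evN mulf_eq0 negb_or => /andP[].
pose f := map_mx i : 'M[K]_2 -> 'M[L]_2.
have fM (x y : 'M[K]_2) : f (x * y) = f x * f y by apply: map_mxM.
have PP : f P^-1 * f P = 1 by rewrite -fM mulVr //; apply: map_mx1.
have ufP : f P \is a GRing.unit by have [] := mulmx1_unit PP.
have fPV : f P^-1 = (f P)^-1 by rewrite (mx_inv_eq PP).
(* In order: integrality of g, the balls of radius c rho(a) around a and c rho(b) around b, and the
   balls of radius c around 0, 1 and infinity. *)
pose Bs := [:: 1; mx2 (i c * ev r s a) a 0 1; mx2 (i c * ev r s b) b 0 1;
  mx2 (i c) 0 0 1; mx2 (i c) 1 0 1; mx2 1 0 0 (i c)].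
have uB j : (j < 6)%N -> Bs`_j \is a GRing.unit.
  have ic0 := in0 _ c0.
  case: j => [|[|[|[|[|[|j]]]]]] //= _; rewrite ?unitr1 // mx2_unit
    ?mulr1 ?mul1r ?mulr0 ?subr0 ?mulf_neq0 //.
exists L, 6%N, (fun j => conjM V (f P * Bs`_j)); split=> //.
  by move=> j; apply: conjM_maximal => //; rewrite mx_unitM ufP uB.
move=> z; pose y := P^-1 * z * P.
have cj (j : 'I_6) : conjM V (f P * Bs`_j) (f z) <-> conjM V Bs`_j (f y).
  rewrite /conjM invrM ?uB // /y !fM fPV -!mulrA; by [].
have Rzy : R z <-> exists k x, [/\ O k, conjR P Rt x & y = k%:M + c *: x].
  rewrite RE; split=> -[k [x [hk hx e]]].
    exists k, (P^-1 * x * P); rewrite /conjR mx_conjK //; split=> //.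
    rewrite /y e mulrDr mulrDl -scalerAr -scalerAl; congr (_ + _).
    by rewrite -scalemx1 -scalerAr mulr1 -scalerAl mulVr.
  exists k, (P * x * P^-1); split=> //.
  rewrite -(mx_conjK z uP) -/y e mulrDr mulrDl -scalerAr -scalerAl; congr (_ + _).
  by rewrite -scalemx1 -scalerAr mulr1 -scalerAl mulrV.
rewrite -/f.
suff main : R z <-> forall j, (j < 6)%N -> conjM V Bs`_j (f y).
  rewrite main; split=> h j; first by apply/cj/h.
  by move=> hj; apply/(cj (Ordinal hj)).
rewrite Rzy; move: y {cj Rzy} => y; rewrite (mx2E y).
move: (y 0 0) (y 0 1) (y 1 0) (y 1 1) => {y z} A B C D.
have fy : f (mx2 A B C D) = mx2 (i A) (i B) (i C) (i D) by apply: map_mx2.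
rewrite fy.
have ic0 := in0 _ c0.
have Vic : V (i c) by apply/OV.
have Vra : V (i c * ev r s a) by apply: (vrM hV) => //; apply: evV.
have Vrb : V (i c * ev r s b) by apply: (vrM hV) => //; apply: evV.
have cra0 : i c * ev r s a != 0 by rewrite mulf_neq0.
have crb0 : i c * ev r s b != 0 by rewrite mulf_neq0.
pose phi p := i B + (i A - i D) * p - i C * p * p.
split=> [[k [x [hk /hRt[e [g [h [w [he hg hh hw ->]]]]] ey]]]|H].
  move: ey; rewrite toprow_quadM !mx2_simp => /mx2_inj[].
  set t1 := r * (h * l + w) + s * h; set t2 := r * (h * m) + s * w => eA eB eC eD.
  have gV : mxV V (mx2 (i A) (i B) (i C) (i D)).
    by apply/mxV_mx2; split; apply/OV; rewrite ?eA ?eB ?eC ?eD /t1 /t2; vr_closed hO.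
  have ph p : V p -> p * p = i l * p + i m -> ev r s p != 0 ->
      V (phi p / (i c * ev r s p)).
    move=> Vp ep rp0.
    (* The scalar and the O[C] part contribute 0, as (p, 1) is an eigenvector; the rest contributes
       c rho(p) times the eigenvalue h p + w. *)
    have -> : phi p = i c * ev r s p * ev h w p.
      rewrite /phi /ev eA eB eC eD /t1 /t2 !(iD, iM, iN) i0.
      have T (x1 x2 x3 : L) : p * p = i l * p + i m ->
          x1 + x2 * p - x3 * p * p = x1 + x2 * p - x3 * (i l * p + i m).
        by move=> <-; ring.
      rewrite T //.
      have -> : i c * (i r * p + i s) * (i h * p + i w) = i c * (i r * i h * (p * p)
        + (i r * i w + i s * i h) * p + i s * i w) by ring.
      rewrite ep; ring.
    by rewrite mulrC mulKf ?mulf_neq0 //; apply: evV.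
  have VO u : O u -> V (i u) by move=> ?; apply/OV.
  case=> [|[|[|[|[|[|j]]]]]] //= _.
  - by rewrite /conjM invr1 mul1r mulr1.
  - by apply/conjM_ball => //; apply: ph.
  - by apply/conjM_ball => //; apply: ph.
  - apply/conjM_ball => //; have := VO _ (_ : O (B / c)).
    rewrite iM iV mulr0 addr0 mulr0 subr0; apply.
    by rewrite eB add0r mulrC mulKf // /t2; vr_closed hO.
  - apply/conjM_ball => //; have := VO _ (_ : O ((B + (A - D) - C) / c)).
    rewrite !(iM, iV, iD, iN) !mulr1; apply.
    have -> : (B + (A - D) - C) / c = g * 0 + (e * m + t2 + (e * l + g + t1 - (g + 0)) - (e + 0)).
      by rewrite eA eB eC eD; field.
    by rewrite /t1 /t2; vr_closed hO.
  - apply/conjM_diag => //; have := VO _ (_ : O (C / c)); rewrite iM iV; apply.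
    by rewrite eC add0r mulrC mulKf // addr0.
have gV : mxV V (mx2 (i A) (i B) (i C) (i D)).
  by have := H 0%N isT; rewrite /conjM /= invr1 mul1r mulr1.
move/mxV_mx2: (gV) => [/OV hA /OV hB /OV hC /OV hD].
have pa : V (phi a / (i c * ev r s a)).
  by have := H 1%N isT => /conjM_ball; apply.
have pb : V (phi b / (i c * ev r s b)).
  by have := H 2%N isT => /conjM_ball; apply.
have OB : O (B / c).
  have /(conjM_ball hV gV V0 Vic ic0) := H 3%N isT.
  by rewrite mulr0 addr0 mulr0 subr0 -iV -iM => /OV.
have OC : O (C / c).
  have /(conjM_diag hV gV Vic ic0) := H 5%N isT.
  by rewrite -iV -iM => /OV.
have OAD : O ((A - D) / c).
  have /(conjM_ball hV gV V1 Vic ic0) := H 4%N isT.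
  rewrite !mulr1 -iV -!(iN, iD) -iM => /OV h.
  have -> : (A - D) / c = (B + (A - D) - C) / c - B / c + C / c by ring.
  by vr_closed hO.
(* Subtract [D], divide by [c], and remove the multiple of the companion matrix dictated by the
   lower left entry: the top row [h], [k] is left, and [e], [g] is its quotient by rho. *)
pose h := (A - D) / c - C / c * l; pose k := B / c - C / c * m.
pose e := (h * s - k * r) / norm2 l m r s.
pose g := (k * (s + r * l) - h * r * m) / norm2 l m r s.
have E := toprow_div h k n0; rewrite -/e -/g in E.
clearbody e g; move: E; rewrite toprow_quadM => /mx2_inj[Eh Ek _ _].
have evE p : p * p = i l * p + i m -> ev r s p != 0 ->
    phi p / (i c * ev r s p) = ev e g p.
  move=> ep rp0.
  suff -> : phi p = i c * (ev r s p * ev e g p) by rewrite mulrA mulrC mulKf ?mulf_neq0.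
  have -> : ev r s p * ev e g p = i h * p + i k.
    rewrite Eh Ek /ev !(iD, iM).
    have -> : (i r * p + i s) * (i e * p + i g) = i r * i e * (p * p)
        + (i r * i g + i s * i e) * p + i s * i g by ring.
    by rewrite ep; ring.
  have -> : phi p = i B + (i A - i D) * p - i C * (i l * p + i m) by rewrite -ep /phi; ring.
  rewrite /h /k !(iD, iM, iN, iV); field; exact: ic0.
move: pa pb; rewrite !evE // => pa pb.
(* The sum and product of e a + g and e b + g are the trace and norm needed; they lie in K and are
   integral over O, hence are in O. *)
have [he hg] : O e /\ O g.
  apply: (good_maximal hv hl hm gd); apply/OV.
    have := vrD hV pa pb; rewrite /ev -/i !(iD, iM) -eab.
    by congr V; rewrite -/i; ring.
  have := vrM hV pa pb; congr V; rewrite /ev -/(i _) !(iD, iM, iN).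
  have -> : (i e * a + i g) * (i e * b + i g) =
      i e * i e * (a * b) + i e * i g * (a + b) + i g * i g by ring.
  by rewrite pab eab -/i; ring.
exists D, (mx2 ((A - D) / c) (B / c) (C / c) 0); split=> //.
  apply/hRt; exists (C / c), 0, e, g; split=> //; first by vr_closed hO.
  by rewrite toprow_quadM -Eh -Ek mx2D /h /k; congr mx2; ring.
by rewrite !mx2_simp; congr mx2; field.
Qed.

End Main.

Theorem theorem1p1 (K : fieldType) (v : K -> int) (hK : nonarch_local_field v)
  (R : 'M[K]_2 -> Prop) (hR : full_order (valring v) R) :
  ghost_intersection v R <->
  exists Rt : 'M[K]_2 -> Prop, gor_closure (valring v) R Rt /\ Bass (valring v) Rt.
Proof.
have [pi [pi0 vpi]] : exists pi, pi != 0 /\ v pi = 1 by case: hK => -[].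
split=> [gR|[Rt [cR bR]]]; first exact: (ghost_Bass_closure hK pi0 vpi hR gR).
exact: (Bass_closure_ghost hK pi0 vpi bR cR).
Qed.
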